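(* Let $\mathfrak{g}$ be a finite-dimensional real Lie algebra with a nil-invariant symmetric bilinear form $\langle\cdot,\cdot\rangle$, and let $\mathfrak{g}=(\mathfrak{k}\times\mathfrak{s})\ltimes\mathfrak{r}$ be a Levi decomposition, where $\mathfrak{r}$ is the solvable radical, $\mathfrak{k}$ is semisimple of compact type and $\mathfrak{s}$ is semisimple without factors of compact type; put $\mathfrak{g}_{\rm s}=\mathfrak{s}\ltimes\mathfrak{r}$. Assume that $\mathfrak{g}^\perp$ does not contain any non-trivial ideal of $\mathfrak{g}$. If in addition $\langle\cdot,\cdot\rangle$ is $\mathfrak{g}^\perp$-invariant, then $$[\mathfrak{g}^\perp,\mathfrak{g}_{\rm s}]=\{0\}.$$
   Context: Nil-invariance: let $\overline{\mathrm{Inn}(\mathfrak{g})}^{\rm z}$ be the Zariski closure of the adjoint group $\mathrm{Inn}(\mathfrak{g})$ in $\mathrm{Aut}(\mathfrak{g})$. A symmetric bilinear form $\langle\cdot,\cdot\rangle$ on $\mathfrak{g}$ (possibly degenerate) is nil-invariant if $\langle\varphi X_1,X_2\rangle=-\langle X_1,\varphi X_2\rangle$ for all $X_1,X_2\in\mathfrak{g}$ and all nilpotent elements $\varphi$ of the Lie algebra of $\overline{\mathrm{Inn}(\mathfrak{g})}^{\rm z}$. $\mathfrak{g}^\perp=\{X\mid\langle X,\mathfrak{g}\rangle=0\}$ is the kernel of the form. The form is $\mathfrak{g}^\perp$-invariant if $\langle[X,Y_1],Y_2\rangle=-\langle Y_1,[X,Y_2]\rangle$ for all $X\in\mathfrak{g}^\perp$,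 $Y_1,Y_2\in\mathfrak{g}$. A semisimple Lie algebra is of compact type if its Killing form is definite. ''Non-trivial ideal'' means non-zero ideal. *)

(* Defs.v *)
From HB Require Import structures.
From mathcomp Require Import all_boot all_order all_algebra.
From mathcomp Require Import all_classical all_reals all_analysis.
(* Not imported: the notations of mpoly clash with those of MathComp-Analysis. *)
From mathcomp Require mpoly.

Set Implicit Arguments.
Unset Strict Implicit.
Unset Printing Implicit Defensive.

Import Order.TTheory GRing.Theory Num.Theory.
Import numFieldNormedType.Exports.

Local Open Scope classical_set_scope.
Local Open Scope ring_scope.

HB.mixin Record Vector_isLieAlgebra (R : fieldType) g of Vector R g := {
  lie : g -> g -> g;
  lie_bilinear_subproof : bilinear_for *:%R *:%R lie;
  liexx : forall x, lie x x = 0;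
  lie_jacobi : forall x y z,
    lie x (lie y z) + lie y (lie z x) + lie z (lie x y) = 0
}.

#[short(type="lieAlgType")]
HB.structure Definition LieAlgebra (R : fieldType) :=
  { g of Vector R g & Vector_isLieAlgebra R g }.

HB.instance Definition _ (R : fieldType) (g : lieAlgType R) :=
  bilinear_isBilinear.Build R g g g *:%R *:%R (@lie R g)
    (@lie_bilinear_subproof R g).

HB.instance Definition _ (R : fieldType) (g : lieAlgType R) (x : g) :=
  GRing.isLinear.Build R g g *:%R (lie x) ((@lie_bilinear_subproof R g).2 x).

Section LieTheory.
Variables (R : fieldType) (g : lieAlgType R).
Implicit Types (U V I : {vspace g}) (x y : g).

Definition ad x : 'End(g) := linfun (lie x).

Definition lie_span U V : {vspace g} :=
  <<[seq lie x y | x <- vbasis U, y <- vbasis V]>>%VS.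

Definition lie_subalgebra U := {in U &, forall x y, lie x y \in U}.

(* I is an ideal of the subalgebra U. *)
Definition lie_ideal U I :=
  (I <= U)%VS /\ {in U & I, forall x y, lie x y \in I}.

Definition derived_series U n : {vspace g} := iter n (fun V => lie_span V V) U.

Definition lie_solvable U := exists n, derived_series U n = 0%VS.

Definition solvable_radical I :=
  [/\ lie_ideal fullv I, lie_solvable I &
      forall J, lie_ideal fullv J -> lie_solvable J -> (J <= I)%VS].

Definition lie_semisimple U :=
  lie_subalgebra U /\
  forall I, lie_ideal U I -> lie_solvable I -> I = 0%VS.

(* The Killing form of the subalgebra U, as a Lie algebra in its own right:
   the trace of the restriction of ad x \o ad y to U, for x, y in U. *)
Definition killing U x y : R :=
  \sum_(i < \dim U) coord (vbasis U) i (lie x (lie y (vbasis U)`_i)).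

Definition lie_automorphism (f : 'End(g)) :=
  lker f = 0%VS /\ forall x y, f (lie x y) = lie (f x) (f y).

End LieTheory.

Section EndPower.
Variables (R : fieldType) (V : vectType R).
Implicit Type f : 'End(V).

(* Vector provides no canonical ring structure on 'End(V), which may be 0. *)
Definition lfun_pow f k : 'End(V) := iter k (comp_lfun f) \1%VF.

Definition lfun_nilpotent f := exists k, lfun_pow f k = 0.

(* The value at f of a polynomial in the coordinates of 'End(V). *)
Definition poly_lfun_eval (p : mpoly.mpoly (\dim {:'End(V)}) R) f : R :=
  mpoly.meval (fun i => coord (vbasis {:'End(V)}) i f) p.

End EndPower.

Section RealLie.
Variables (R : realType) (g : lieAlgType R).
Implicit Types (U I k s r : {vspace g}) (x y : g) (f : 'End(g)).

Definition killing_definite U :=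
  {in U, forall x, x != 0 -> 0 < killing U x x} \/
  {in U, forall x, x != 0 -> killing U x x < 0}.

Definition compact_type U := lie_semisimple U /\ killing_definite U.

(* No direct factor of U other than 0 is semisimple of compact type. *)
Definition no_compact_factor U :=
  forall I J, lie_ideal U I -> lie_ideal U J ->
    (I + J)%VS = U -> (I :&: J)%VS = 0%VS -> compact_type I -> I = 0%VS.

(* g = (k x s) |x r *)
Definition levi_decomposition k s r :=
  [/\ solvable_radical r,
      compact_type k,
      lie_semisimple s /\ no_compact_factor s,
      {in k & s, forall x y, lie x y = 0} &
      (k + s + r)%VS = fullv /\ directv (k + s + r)].

(* The exponential series of f, summed coordinatewise in the
   finite-dimensional space 'End(g). *)
Definition lfun_expR f : 'End(g) :=
  \sum_(i < \dim {:'End(g)})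
    limn (series (fun n => coord (vbasis {:'End(g)}) i (lfun_pow f n) / n`!%:R))
      *: (vbasis {:'End(g)})`_i.

(* The adjoint group Inn(g) is generated by the exp (ad x); it consists of the
   finite products of these, as exp (ad (- x)) is the inverse of exp (ad x). *)
Definition Inn : set 'End(g) :=
  [set f | exists xs : seq g,
     f = foldr (fun x h => (lfun_expR (ad x) \o h)%VF) \1%VF xs].

(* Zariski closure in Aut(g) *)
Definition zariski_closure (S : set 'End(g)) : set 'End(g) :=
  [set f | lie_automorphism f /\
     forall p, (forall h, S h -> poly_lfun_eval p h = 0) ->
       poly_lfun_eval p f = 0].

(* The Lie algebra of a closed subgroup S of GL(g), as a subalgebra of gl(g). *)
Definition lie_algebra_of (S : set 'End(g)) : set 'End(g) :=
  [set f | forall t : R, S (lfun_expR (t *: f))].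

Variable form : {symmetric g}.

Definition nil_invariant :=
  forall f, lie_algebra_of (zariski_closure Inn) f -> lfun_nilpotent f ->
    forall x y, form (f x) y = - form x (f y).

Definition form_kernel : {vspace g} := orthov form fullv.

Definition kernel_invariant :=
  {in form_kernel, forall x, forall y1 y2,
    form (lie x y1) y2 = - form y1 (lie x y2)}.

End RealLie.

(* Main.v *)
Require Import Defs.
From HB Require Import structures.
From mathcomp Require Import all_boot all_order all_algebra.
From mathcomp Require Import ring lra.
From mathcomp.real_closed Require Import complex.
From mathcomp Require Import all_classical all_reals all_analysis.
From mathcomp Require mpoly.

Set Implicit Arguments.
Unset Strict Implicit.
Unset Printing Implicit Defensive.

Import Order.TTheory GRing.Theory Num.Theory.
Import passmx.
Import numFieldNormedType.Exports.

Local Open Scope ring_scope.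

(** The nilpotent part of every ad x lies in the Lie algebra of the Zariski
closure of Inn(g), because exp (ad x) is the commuting product of its semisimple
and unipotent parts, and a polynomial vanishing on all powers of the product
vanishes on the one-parameter group of the unipotent part. Hence the form is
invariant under every x with ad x nilpotent. For x in r the image of the Fitting one-component
of ad x consists of such elements, and on the null component ad x is nilpotent,
so the form is r-invariant. For h in s the eigenvectors of the real part of ad h
in s for non-zero eigenvalues are ad-nilpotent; they generate an ideal, and on
the Killing complement of the largest ideal of s that leaves the form invariant
all real parts vanish, so that this complement is of compact type, hence 0.
Thus the form is g_s-invariant.

Let t be the orthogonal of [g, g_s] and t1 the set of the v in t with [g, v]
contained in t. By g_s-invariance and definiteness of the Killing form of k, t1 is
an ideal of g, and [t1, g_s] lies in the kernel K of the form; K-invariance puts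
K into t1. So [t1, g_s] is an ideal of g inside K, hence zero, and [K, g_s]
vanishes with it. *)

(** * Spectral calculus of real matrices *)

(** The Lie algebra is never complexified. Complex eigenvalues enter only through matrices: in a
    frame diagonalising the semisimple part of f, every function phi of the eigenvalues that
    commutes with conjugation is realised by a real polynomial in f. The semisimple part, the real
    part, pseudo-inverses and eigenprojections are the choices phi(z) = z, Re z, 1/z or 1/Re z (with
    1/0 = 0) and the indicator of Re z = a. Being polynomials in f, these operators preserve every
    f-stable subspace; when phi is additive and f is a derivation, they are derivations.

    Trace computations in such frames take the place of Lie's theorem: an endomorphism whose
    positive powers all have trace 0 is nilpotent.

    The obstacle at the end is k, whose elements are not known to leave the form invariant. The
    orthogonal t is therefore not visibly an ideal: only its part inside g_s is stable under g. This
    is why t1 is introduced, and why the semisimplicity of [ad] on k, forced by definiteness, is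
    needed to see that t1 is an ideal. *)

Lemma crt_poly (F : fieldType) (rs : seq F) n (phi : F -> F) : uniq rs ->
  exists q : {poly F}, forall x, x \in rs -> ('X - x%:P) ^+ n %| q - (phi x)%:P.
Proof.
elim: rs => [|y rs IH] /=; first by exists 0.
case/andP=> yrs /IH [q Hq].
pose P := \prod_(x <- rs) ('X - x%:P) ^+ n.
have cop : coprimep P (('X - y%:P) ^+ n).
  rewrite /P big_seq; elim/big_rec: _ => [|x p xrs cp]; first exact: coprime1p.
  rewrite coprimepMl cp andbT.
  by rewrite coprimep_expl // coprimep_expr // coprimep_XsubC root_XsubC eq_sym; apply: contraNneq yrs => <-.
have [[u v] /= Huv] := Bezout_eq1_coprimepP _ _ cop.
(* [u * P] is 0 modulo the earlier factors and 1 modulo the new one, so the added term changes only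
   the residue at [y]. *)
exists (q + ((phi y)%:P - q) * (u * P)) => x; rewrite inE => /orP[/eqP->|xrs].
  have -> : q + ((phi y)%:P - q) * (u * P) - (phi y)%:P
    = - (((phi y)%:P - q) * v) * ('X - y%:P) ^+ n.
    have -> : u * P = 1 - v * ('X - y%:P) ^+ n by rewrite -Huv addrK.
    by ring.
  exact: dvdp_mull.
rewrite addrAC dvdp_add ?Hq //; apply/dvdp_mull/dvdp_mull.
by rewrite /P (big_rem x) //= dvdp_mulr.
Qed.

Section Conj.
Local Open Scope complex_scope.
Variable R : rcfType.
Local Notation C := R[i].
Local Notation toC := (real_complex R).
Local Notation conjC := (@conjc R).

(** Averaging a complex solution with its conjugate gives a real one: since [rs] is stable and [phi]
    equivariant under conjugation, the conjugate polynomial satisfies the same congruences. *)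
Lemma crt_real_poly (rs : seq C) n (phi : C -> C) :
  uniq rs -> (forall x, x \in rs -> conjC x \in rs) ->
  (forall x, phi (conjC x) = conjC (phi x)) ->
  exists q : {poly R}, forall x, x \in rs ->
    ('X - x%:P) ^+ n %| map_poly toC q - (phi x)%:P.
Proof.
move=> urs crs phic; have [q Hq] := crt_poly n phi urs.
pose qc := map_poly conjC q.
exists (\poly_(i < size q) complex.Re q`_i) => x xrs.
have E : map_poly toC (\poly_(i < size q) complex.Re q`_i) = 2%:R^-1 *: (q + qc).
  apply/polyP => i; rewrite coefZ coefD coef_map coef_map coef_poly /=.
  case: ltnP => [_|/leq_sizeP ->] //; last by rewrite !rmorph0 addr0 mulr0.
  by rewrite ReJ_add mulrC.
rewrite E.
have -> : 2%:R^-1 *: (q + qc) - (phi x)%:P =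
  2%:R^-1 *: ((q - (phi x)%:P) + (qc - (phi x)%:P)).
  rewrite addrACA -opprD scalerBr; congr (_ - _).
  by rewrite -polyCD -mul_polyC -polyCM -mulr2n -[phi x *+ 2]mulr_natl mulrA mulVf ?mul1r // pnatr_eq0.
rewrite -mul_polyC dvdp_mull // dvdp_add ?Hq //.
have /dvdpP [r Hr] := Hq _ (crs _ xrs).
have -> : qc - (phi x)%:P = map_poly conjC (q - (phi (conjC x))%:P).
  by rewrite rmorphB /= map_polyC /= -phic conjcK.
rewrite Hr rmorphM /= rmorphXn /= rmorphB /= map_polyX map_polyC /= conjcK.
exact: dvdp_mull.
Qed.

Lemma horner_mx_dvd n (A : 'M[C]_n.+1) p q :
  p %| q -> horner_mx A p = 0 -> horner_mx A q = 0.
Proof. by move=> /dvdpP[r ->] pA; rewrite rmorphM /= pA mulr0. Qed.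

Lemma prod_XsubC_exp_dvd (rs : seq C) m (p : {poly C}) : uniq rs ->
  (forall x, x \in rs -> ('X - x%:P) ^+ m %| p) ->
  \prod_(x <- rs) ('X - x%:P) ^+ m %| p.
Proof.
elim: rs => [|y rs IH] /=; first by rewrite big_nil dvd1p.
case/andP=> yrs urs Hp; rewrite big_cons Gauss_dvdp.
  by rewrite Hp ?mem_head //= IH // => x xrs; rewrite Hp // inE xrs orbT.
rewrite big_seq; elim/big_rec: _ => [|x q xrs cq]; first exact: coprimep1.
rewrite coprimepMr cq andbT coprimep_expl // coprimep_expr // coprimep_XsubC root_XsubC.
by apply: contraNneq yrs => <-.
Qed.

Lemma mulmx_diag_row n (P Q : 'M[C]_n) (d : 'rV[C]_n) :
  (forall i, row i P *m Q = d 0 i *: row i P) -> P *m Q = diag_mx d *m P.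
Proof. by move=> H; apply/row_matrixP => i; rewrite !row_mul H row_diag_mx -scalemxAl -rowE. Qed.

Lemma row_mulmx_diag n (P Q : 'M[C]_n) (d : 'rV[C]_n) i :
  P *m Q = diag_mx d *m P -> row i P *m Q = d 0 i *: row i P.
Proof. by move=> H; rewrite -row_mul H row_mul row_diag_mx -scalemxAl -rowE. Qed.

(** By Cayley-Hamilton, congruences modulo high powers of the linear factors determine a polynomial
    in M. Interpolating the identity yields the semisimple part, diagonalised by P, with M minus it
    nilpotent; any other [phi], interpolated in the same way, acts on row i of P as the scalar
    [phi (d 0 i)]. *)
Lemma spectral_poly n (M : 'M[R]_n.+1) :
  exists (P : 'M[C]_n.+1) (d : 'rV[C]_n.+1), [/\ P \in unitmx,
    forall i, root (map_poly toC (char_poly M)) (d 0 i),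
    forall phi : C -> C, (forall x, phi (conjC x) = conjC (phi x)) ->
      exists q : {poly R},
        P *m map_mx toC (horner_mx M q) = diag_mx (map_mx phi d) *m P &
    exists q : {poly R},
      P *m map_mx toC (horner_mx M q) = diag_mx d *m P /\
      exists k, (M - horner_mx M q) ^+ k = 0].
Proof.
pose MC := map_mx toC M; pose cp := map_poly toC (char_poly M).
have cpE : cp = char_poly MC by rewrite /cp map_char_poly.
have cpM : horner_mx MC cp = 0 by rewrite cpE Cayley_Hamilton.
have [l Hl] := closed_field_poly_normal cp.
have lc : lead_coef cp = 1 by rewrite cpE (eqP (char_poly_monic _)).
rewrite lc scale1r in Hl.
pose rs := undup (l ++ map conjC l); pose m := size l.
have urs : uniq rs by rewrite undup_uniq.
have crs x : x \in rs -> conjC x \in rs.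
  rewrite !mem_undup !mem_cat => /orP[xl|/mapP[y yl ->]].
    by rewrite map_f ?orbT.
  by rewrite conjcK yl.
have lrs x : x \in l -> x \in rs by rewrite mem_undup mem_cat => ->.
have cpD : cp %| \prod_(x <- rs) ('X - x%:P) ^+ m.
  rewrite Hl -(prodr_undup_exp_count _ predT) /=.
  have: {subset undup l <= rs} by move=> x; rewrite mem_undup => /lrs.
  have: all (fun x => count_mem x l <= m)%N (undup l).
    by apply/allP => x _; apply: count_size.
  move: (undup_uniq l); move: (undup l) => ul; clearbody rs.
  elim: ul rs urs {crs lrs} => [|x ul IH] rs urs /=; first by rewrite big_nil dvd1p.
  case/andP=> xul uul /andP[cx cul] sub.
  rewrite big_cons [X in _ %| X](big_rem x) /=; last by apply: sub; rewrite mem_head.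
  apply: dvdp_mul; first exact: dvdp_exp2l.
  apply: IH => //; first exact: rem_uniq.
  move=> y yul; rewrite mem_rem_uniq //; apply/andP; split.
    by apply: contraNneq xul => <-.
  by apply: sub; rewrite inE yul orbT.
have div0 p : (forall x, x \in rs -> ('X - x%:P) ^+ m %| p) -> horner_mx MC p = 0.
  move=> Hp; apply: horner_mx_dvd cpM; apply: dvdp_trans cpD _.
  exact: prod_XsubC_exp_dvd.
have m_gt0 : (0 < m)%N.
  rewrite lt0n; apply/negP => /nilP l0; move: (size_char_poly MC).
  by rewrite -cpE Hl l0 big_nil size_poly1.
have div1 p : (forall x, x \in rs -> root p x) -> horner_mx MC (p ^+ m) = 0.
  move=> Hp; apply: div0 => x /Hp; rewrite root_factor_theorem => xp.
  exact: dvdp_exp2r.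
have hC q : map_mx toC (horner_mx M q) = horner_mx MC (map_poly toC q).
  exact: map_horner_mx.
have [q0 Hq0] := crt_real_poly m urs crs (phi := id) (fun=> erefl).
pose q0C := map_poly toC q0.
have X_root (x : C) p (c : C) : ('X - x%:P) ^+ m %| p - c%:P -> p.[x] = c.
  move=> H; have : 'X - x%:P %| p - c%:P.
    by apply: dvdp_trans H; rewrite -{1}['X - _]expr1 dvdp_exp2l.
  by rewrite -root_factor_theorem /root hornerD hornerN hornerC subr_eq0 => /eqP.
have Nnil : horner_mx MC (('X - q0C) ^+ m) = 0.
  by apply: div1 => x xrs; rewrite /root !hornerE (X_root _ _ _ (Hq0 _ xrs)) subrr.
have Sdiag : exists2 P, P \in unitmx & exists d : 'rV[C]_n.+1,
    P *m horner_mx MC q0C = diag_mx d *m P.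
  have : diagonalizable (horner_mx MC q0C).
    (* The product of the distinct factors X - x annihilates the semisimple part, because each
       [q0C - x%:P] is divisible by the m-th power of X - x. *)
    apply/diagonalizableP; exists rs => //; apply: mxminpoly_min.
    rewrite rmorph_prod /=.
    have -> : \prod_(x <- rs) horner_mx (horner_mx MC q0C) ('X - x%:P)
      = horner_mx MC (\prod_(x <- rs) (q0C - x%:P)).
      rewrite rmorph_prod /=; apply: eq_bigr => x _.
      by rewrite !rmorphB /= horner_mx_X !horner_mx_C.
    by apply: div0 => x xrs; rewrite (big_rem x) //= dvdp_mulr // Hq0.
  case=> P Pu /diagonalizable_forPex[d /simmxPp Pd]; exists P => //; exists d.
  by apply: Pd; apply: stablemx_unit.
have [P Pu [d Pd]] := Sdiag.
have rowd i : row i P *m horner_mx MC q0C = d 0 i *: row i P by apply: row_mulmx_diag.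
have rowP0 i : row i P != 0.
  apply: contraTneq Pu => /(congr1 (mulmx^~ (invmx P))); rewrite mul0mx -row_mul.
  case: (boolP (P \in unitmx)) => // Pu; rewrite mulmxV // => /rowP/(_ i).
  by rewrite !mxE eqxx => /eqP; rewrite oner_eq0.
(* On an eigenvector of the semisimple part, M - d_i acts as the nilpotent part. *)
have rowgen i : row i P *m (horner_mx MC (('X - (d 0 i)%:P) ^+ m)) = 0.
  have -> : row i P *m horner_mx MC (('X - (d 0 i)%:P) ^+ m)
      = row i P *m horner_mx MC (('X - q0C) ^+ m).
    elim: m {rs urs crs lrs cpD div0 m_gt0 div1 Hq0 X_root Nnil Sdiag} => [|k IH]; first by rewrite !expr0.
    rewrite exprS rmorphM /= mulmxA.
    have -> : row i P *m horner_mx MC ('X - (d 0 i)%:P) = row i P *m horner_mx MC ('X - q0C).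
      by rewrite !rmorphB /= !mulmxBr rowd horner_mx_X horner_mx_C mul_mx_scalar.
    rewrite -mulmxA.
    have /= -> : horner_mx MC ('X - q0C) *m horner_mx MC (('X - (d 0 i)%:P) ^+ k)
       = horner_mx MC (('X - (d 0 i)%:P) ^+ k) *m horner_mx MC ('X - q0C).
      exact: comm_horner_mx2.
    by rewrite mulmxA IH -mulmxA [in RHS]exprSr rmorphM.
  by rewrite Nnil mulmx0.
(* The last non-zero vector among the v (M - d_i)^j is an eigenvector of M. *)
have droot i : root cp (d 0 i).
  rewrite cpE -eigenvalue_root_char; apply/eigenvalueP.
  move: (rowP0 i) (rowgen i); move: (row i P); clear; elim: m => [|k IH] v v0.
    by rewrite expr0 rmorph1 mulmx1 => E; rewrite E eqxx in v0.
  rewrite exprS rmorphM /= mulmxA.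
  have [E _|ne] := eqVneq (v *m horner_mx MC ('X - (d 0 i)%:P)) 0; last exact: IH.
  exists v => //; apply/eqP; rewrite -subr_eq0; move/eqP: E.
  by rewrite rmorphB /= mulmxBr horner_mx_X horner_mx_C mul_mx_scalar.
have dl i : d 0 i \in rs.
  by apply: lrs; have := droot i; rewrite Hl root_prod_XsubC.
exists P, d; split => //.
  move=> phi phic; have [q Hq] := crt_real_poly m urs crs phic; exists q.
  apply: mulmx_diag_row => i; rewrite hC mxE.
  have /dvdpP[r Hr] := Hq _ (dl i).
  have -> : map_poly toC q = ('X - (d 0 i)%:P) ^+ m * r + (phi (d 0 i))%:P by rewrite mulrC -Hr subrK.
  by rewrite rmorphD rmorphM /= mulmxDr mulmxA rowgen mul0mx add0r horner_mx_C mul_mx_scalar.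
exists q0; rewrite hC; split => //; exists m.
apply: (map_mx_inj (f := toC)); rewrite map_mx0.
have -> : (M - horner_mx M q0) ^+ m = horner_mx M (('X - q0) ^+ m).
  by rewrite rmorphXn rmorphB /= horner_mx_X.
by rewrite hC rmorphXn rmorphB /= map_polyX Nnil.
Qed.
End Conj.

(** * Derivations and generalized eigenspaces, in matrix form *)

Section FrameDerivation.
Variables (F : fieldType) (n : nat).
Implicit Types (M S Q P N : 'M[F]_n) (u w z : 'rV[F]_n) (d : 'rV[F]_n).

Lemma comm_mxB_scalar S M a : S *m M = M *m S ->
  (M - S) *m (M - a%:M) = (M - a%:M) *m (M - S).
Proof.
by move=> SM; rewrite !mulmxBl !mulmxBr SM -!scalar_mxC !opprB addrACA [- _ - _]addrC [LHS]addrACA.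
Qed.

Lemma mulmx_eigen_exp u S M a k : S *m M = M *m S -> u *m S = a *: u ->
  u *m (M - a%:M) ^+ k = u *m (M - S) ^+ k.
Proof.
move=> SM uS; elim: k => [|k IH]; first by rewrite !expr0.
rewrite exprS -[_ * _]/(_ *m _) mulmxA.
have -> : u *m (M - a%:M) = u *m (M - S).
  by rewrite !mulmxBr uS mul_mx_scalar.
have /commrX : GRing.comm (M - S) (M - a%:M).
  exact: comm_mxB_scalar.
move=> /(_ k) E; rewrite -mulmxA.
have -> : (M - S) *m (M - a%:M) ^+ k = (M - a%:M) ^+ k *m (M - S) by exact: E.
by rewrite exprSr mulmxA IH -mulmxA.
Qed.

Lemma mulmx_exp_sub0 u (X Y : 'M[F]_n) a b : X *m Y = Y *m X ->
  u *m X ^+ a = 0 -> u *m Y ^+ b = 0 -> u *m (X - Y) ^+ (a + b) = 0.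
Proof.
move=> XY; move: {2}(a + b)%N (leqnn (a + b)) => m.
elim: m a b u => [|m IH] a b u.
  by rewrite leqn0 addn_eq0 => /andP[/eqP-> /eqP->]; rewrite !expr0.
case: a => [_|a]; first by rewrite expr0 mulmx1 => ->; rewrite !mul0mx.
case: b => [_ _|b]; first by rewrite expr0 mulmx1 => ->; rewrite !mul0mx.
move=> ab uX uY.
rewrite addSn exprS -[_ * _]/(_ *m _) mulmxA mulmxBr mulmxBl.
have XYk k : X ^+ k *m Y = Y *m X ^+ k by apply: esym; apply: (@commrX _ Y X k); rewrite /GRing.comm; exact: (esym XY).
have YXk k : Y ^+ k *m X = X *m Y ^+ k by apply: esym; apply: (@commrX _ X Y k); rewrite /GRing.comm; exact: XY.
rewrite IH ?addnS ?subr0 //; last 2 first.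
- by rewrite -mulmxA; rewrite exprS in uX.
- by rewrite -mulmxA -YXk mulmxA uY mul0mx.
rewrite -addSn IH ?subr0 //.
- by rewrite addSn -addnS.
- by rewrite -mulmxA -XYk mulmxA uX mul0mx.
- by rewrite -mulmxA; rewrite exprS in uY.
by rewrite -ltnS -addnS -addSn.
Qed.

Lemma mulmx_diag_exp u d k i :
  (u *m diag_mx d ^+ k) 0 i = u 0 i * d 0 i ^+ k.
Proof.
elim: k => [|k IH]; first by rewrite !expr0 mulmx1 mulr1.
by rewrite !exprSr -[_ * diag_mx _]/(_ *m _) mulmxA mul_mx_diag mxE IH mulrA.
Qed.

(** Only the frame coordinates with d_i = a can be non-zero in z: S is diagonalisable, so its
    generalized eigenvectors are eigenvectors. *)
Lemma geneigen_frame P S Q d (phi : F -> F) z a k : P \in unitmx ->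
  P *m S = diag_mx d *m P -> P *m Q = diag_mx (map_mx phi d) *m P ->
  z *m (S - a%:M) ^+ k = 0 -> z *m Q = phi a *: z.
Proof.
move=> Pu PS PQ; pose y := z *m invmx P.
have -> : z = y *m P by rewrite mulmxKV.
have PSk : P *m (S - a%:M) ^+ k = diag_mx (d - const_mx a) ^+ k *m P.
  have E : P *m (S - a%:M) = diag_mx (d - const_mx a) *m P.
    by rewrite mulmxBr PS linearB /= diag_const_mx mulmxBl mul_mx_scalar mul_scalar_mx.
  elim: k => [|k IH]; first by rewrite !expr0 mulmx1 mul1mx.
  by rewrite !exprS mulmxA E -mulmxA IH mulmxA.
rewrite -mulmxA PSk mulmxA => /(congr1 (mulmx^~ (invmx P))).
rewrite mulmxK // mul0mx => H; rewrite -mulmxA PQ mulmxA scalemxAl; congr (_ *m _).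
apply/rowP => i; rewrite mul_mx_diag !mxE.
have /rowP/(_ i) := H; rewrite mulmx_diag_exp !mxE => /eqP.
rewrite mulf_eq0 => /orP[/eqP->|]; first by rewrite mul0r mulr0.
by rewrite expf_eq0 subr_eq0 => /andP[_ /eqP->]; rewrite mulrC.
Qed.

Variable A : 'I_n -> 'M[F]_n.

(* [A i] is the matrix of ad e_i; the condition says that M is a derivation. *)
Definition derivation_mx M := forall i, A i *m M = M *m A i + \sum_k M i k *: A k.

Definition bracket_mx u w := \sum_i u 0 i *: (w *m A i).

Lemma bracket_mxDl u1 u2 w : bracket_mx (u1 + u2) w = bracket_mx u1 w + bracket_mx u2 w.
Proof. by rewrite -big_split; apply: eq_bigr => i _; rewrite mxE scalerDl. Qed.
Lemma bracket_mxDr u w1 w2 : bracket_mx u (w1 + w2) = bracket_mx u w1 + bracket_mx u w2.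
Proof. by rewrite -big_split; apply: eq_bigr => i _; rewrite mulmxDl scalerDr. Qed.
Lemma bracket_mxZl a u w : bracket_mx (a *: u) w = a *: bracket_mx u w.
Proof. by rewrite scaler_sumr; apply: eq_bigr => i _; rewrite mxE scalerA. Qed.
Lemma bracket_mxZr a u w : bracket_mx u (a *: w) = a *: bracket_mx u w.
Proof.
by rewrite scaler_sumr; apply: eq_bigr => i _; rewrite -scalemxAl scalerA mulrC -scalerA.
Qed.

Lemma derivation_mxP M : derivation_mx M <->
  forall u w, bracket_mx u w *m M = bracket_mx (u *m M) w + bracket_mx u (w *m M).
Proof.
have E u w : \sum_i u 0 i *: (w *m (\sum_k M i k *: A k)) = bracket_mx (u *m M) w.
  under eq_bigr do rewrite mulmx_sumr scaler_sumr.
  rewrite exchange_big; apply: eq_bigr => k _ /=; rewrite !mxE scaler_suml.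
  by apply: eq_bigr => i _; rewrite -scalemxAr scalerA.
split=> [H u w|H i].
  rewrite mulmx_suml -E -big_split; apply: eq_bigr => i _ /=.
  by rewrite -scalemxAl -mulmxA H mulmxDr scalerDr mulmxA addrC.
apply/row_matrixP => j; have := H (delta_mx 0 i) (delta_mx 0 j).
have D w : bracket_mx (delta_mx 0 i) w = w *m A i.
  rewrite /bracket_mx (bigD1 i) //= mxE !eqxx scale1r big1 ?addr0 // => k ki.
  by rewrite mxE eqxx (negbTE ki) scale0r.
have E' w : w *m (\sum_k M i k *: A k) = bracket_mx (delta_mx 0 i *m M) w.
  rewrite -E [RHS](bigD1 i) //= mxE !eqxx scale1r [X in _ = _ + X]big1 ?addr0 // => k ki.
  by rewrite mxE eqxx (negbTE ki) scale0r.
by rewrite -E' !D addrC -!mulmxA -mulmxDr !rowE.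
Qed.

(** By Leibniz, M - (a + b) applied to the bracket becomes M - a on u plus M - b on w; after j + k
    applications every term has exhausted one of the two exponents. *)
Lemma bracket_geneigen M u w a b j k : derivation_mx M ->
  u *m (M - a%:M) ^+ j = 0 -> w *m (M - b%:M) ^+ k = 0 ->
  bracket_mx u w *m (M - (a + b)%:M) ^+ (j + k) = 0.
Proof.
move=> /derivation_mxP dM; move: {2}(j + k)%N (leqnn (j + k)) => m.
have b0l v : bracket_mx 0 v = 0 by rewrite /bracket_mx big1 // => i _; rewrite mxE scale0r.
have b0r v : bracket_mx v 0 = 0 by rewrite /bracket_mx big1 // => i _; rewrite mul0mx scaler0.
elim: m j k u w => [|m IH] j k u w.
  rewrite leqn0 addn_eq0 => /andP[/eqP-> /eqP->]; rewrite !expr0 mulmx1 => -> _.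
  by rewrite b0l mul0mx.
case: j => [_|j]; first by rewrite expr0 mulmx1 => -> _; rewrite b0l mul0mx.
case: k => [_ _|k]; first by rewrite expr0 mulmx1 => ->; rewrite b0r mul0mx.
move=> jk uM wM.
have -> : bracket_mx u w *m (M - (a + b)%:M) ^+ (j.+1 + k.+1)
   = bracket_mx (u *m (M - a%:M)) w *m (M - (a + b)%:M) ^+ (j + k.+1)
     + bracket_mx u (w *m (M - b%:M)) *m (M - (a + b)%:M) ^+ (j.+1 + k).
  rewrite addSn exprS -[_ * _]/(_ *m _) mulmxA addSnnS -mulmxDl; congr (_ *m _).
  rewrite !mulmxBr dM !mul_mx_scalar -!scaleNr.
  by rewrite bracket_mxDl bracket_mxDr bracket_mxZl bracket_mxZr addrACA -scalerDl opprD.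
rewrite !IH ?addr0 -?mulmxA //.
- by rewrite addSnnS -ltnS -addSn.
- by rewrite exprS in wM.
by rewrite exprS in uM.
Qed.

(** The bracket of the generalized eigenspaces for a and b lies in the one for a + b, where Q is the
    scalar phi(a + b) = phi(a) + phi(b). This is the Leibniz rule on frame vectors, and bilinearity
    extends it. *)
Lemma frame_derivation P M S Q d (phi : F -> F) m : P \in unitmx ->
  S *m M = M *m S -> (M - S) ^+ m = 0 -> derivation_mx M ->
  {morph phi : x y / x + y} ->
  P *m S = diag_mx d *m P -> P *m Q = diag_mx (map_mx phi d) *m P ->
  derivation_mx Q.
Proof.
move=> Pu SM N0 dM phiD PS PQ; apply/derivation_mxP.
have rowe X e i : P *m X = diag_mx e *m P -> row i P *m X = e 0 i *: row i P.
  by move=> H; rewrite -row_mul H row_mul row_diag_mx -scalemxAl -rowE.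
have Hij i j : bracket_mx (row i P) (row j P) *m Q
   = bracket_mx (row i P *m Q) (row j P) + bracket_mx (row i P) (row j P *m Q).
  have g i' : row i' P *m (M - (d 0 i')%:M) ^+ m = 0.
    by rewrite (mulmx_eigen_exp (S := S)) ?N0 ?mulmx0 //; apply: rowe.
  rewrite !(rowe _ _ _ PQ) bracket_mxZl bracket_mxZr -scalerDl !mxE -phiD.
  (* The exponent is [m + m] for the bracket of two generalized eigenvectors of M, and [m] more for
     passing from M to S. *)
  apply: (geneigen_frame (k := ((m + m) + m)%N) Pu PS PQ).
  rewrite -[S](subKr M) -addrAC; apply: mulmx_exp_sub0.
  - exact/esym/comm_mxB_scalar.
  - by apply: bracket_geneigen.
  by rewrite N0 mulmx0.
move=> u w.
have sumE v : v = \sum_i (v *m invmx P) 0 i *: row i P by rewrite -mulmx_sum_row mulmxKV.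
have suml (I : finType) (a : I -> F) (x : I -> 'rV[F]_n) v :
    bracket_mx (\sum_i a i *: x i) v = \sum_i a i *: bracket_mx (x i) v.
  elim/big_ind2: _ => [|? ? ? ? <- <-|i _]; rewrite ?bracket_mxDl ?bracket_mxZl //.
  by rewrite /bracket_mx big1 // => i _; rewrite mxE scale0r.
have sumr (I : finType) (a : I -> F) (x : I -> 'rV[F]_n) v :
    bracket_mx v (\sum_i a i *: x i) = \sum_i a i *: bracket_mx v (x i).
  elim/big_ind2: _ => [|? ? ? ? <- <-|i _]; rewrite ?bracket_mxDr ?bracket_mxZr //.
  by rewrite /bracket_mx big1 // => i _; rewrite mul0mx scaler0.
have mulE v : v *m Q = \sum_i (v *m invmx P) 0 i *: (row i P *m Q).
  by rewrite {1}[v]sumE mulmx_suml; apply: eq_bigr => i _; rewrite -scalemxAl.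
rewrite (mulE u) (mulE w) {1 3}[u]sumE !suml mulmx_suml -big_split.
apply: eq_bigr => i _ /=; rewrite -scalemxAl -scalerDr; congr (_ *: _).
rewrite {1 2}[w]sumE !sumr mulmx_suml -big_split.
by apply: eq_bigr => j _ /=; rewrite -scalemxAl -scalerDr Hij.
Qed.

End FrameDerivation.

(** * Polynomials and traces of endomorphisms *)

Section LPoly.
Variable F : fieldType.

Definition lpoly (V : vectType F) (p : {poly F}) (f : 'End(V)) : 'End(V) :=
  \sum_(i < size p) p`_i *: lfun_pow f i.

Definition lmx (V : vectType F) (f : 'End(V)) : 'M[F]_(\dim {:V}) :=
  mxof (vbasis {:V}) (vbasis {:V}) f.

Definition ltr (V : vectType F) (f : 'End(V)) : F := \tr (lmx f).

(** Meaningful in every size, including 0, because the space may be zero. *)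
Definition pmx n (p : {poly F}) (M : 'M[F]_n) : 'M[F]_n :=
  \sum_(i < size p) p`_i *: M ^+ i.

Lemma pmx_horner n p (M : 'M[F]_n.+1) : pmx p M = horner_mx M p.
Proof.
rewrite -[p in RHS]coefK poly_def rmorph_sum /=; apply: eq_bigr => i _.
by rewrite linearZ /= rmorphXn /= horner_mx_X.
Qed.

Section OneSpace.
Variable V : vectType F.
Implicit Types (f g : 'End(V)) (p : {poly F}) (U : {vspace V}).

Lemma lmx1 : lmx (\1%VF : 'End(V)) = 1%:M.
Proof. by rewrite /lmx mxof1 // (basis_free (vbasisP _)). Qed.

Lemma lmx_comp f g : lmx (f \o g)%VF = lmx g *m lmx f.
Proof. by rewrite /lmx (mxof_comp _ _ (vbasisP _)). Qed.

Lemma lmx_is_linear : linear (@lmx V).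
Proof. by move=> a f g; rewrite /lmx linearP. Qed.
HB.instance Definition _ := GRing.isLinear.Build F 'End(V) 'M[F]_(\dim {:V}) _ (@lmx V) lmx_is_linear.

Lemma lmx_inj : injective (@lmx V).
Proof. exact: can_inj (mxofK (vbasisP _) (vbasisP _)). Qed.

Lemma lfun_powS f k : lfun_pow f k.+1 = (f \o lfun_pow f k)%VF. Proof. by []. Qed.

Lemma lmx_pow f k : lmx (lfun_pow f k) = lmx f ^+ k.
Proof.
by elim: k => [|k IH]; [rewrite lmx1 | rewrite lfun_powS lmx_comp IH exprSr].
Qed.

Lemma lmx_poly p f : lmx (lpoly p f) = pmx p (lmx f).
Proof. by rewrite linear_sum; apply: eq_bigr => i _; rewrite linearZ /= lmx_pow. Qed.

Lemma lfun_powE f k v : lfun_pow f k v = iter k f v.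
Proof. by elim: k => [|k IH]; [rewrite id_lfunE | rewrite lfun_powS comp_lfunE IH]. Qed.

Lemma lpolyE p f v : lpoly p f v = \sum_(i < size p) p`_i *: iter i f v.
Proof.
rewrite /lpoly sum_lfunE; apply: eq_bigr => i _; by rewrite scale_lfunE lfun_powE.
Qed.

Lemma lpoly_stable p f U : {in U, forall v, f v \in U} ->
  {in U, forall v, lpoly p f v \in U}.
Proof.
move=> fU v vU; rewrite lpolyE memv_suml // => i _; rewrite memvZ //.
by elim: (nat_of_ord i) => //= k; apply: fU.
Qed.

Lemma ltr_comp f g : ltr (f \o g)%VF = ltr (g \o f)%VF.
Proof. by rewrite /ltr !lmx_comp mxtrace_mulC. Qed.

Lemma ltr_is_linear : scalar (@ltr V).
Proof. by move=> a f g; rewrite /ltr linearP /= mxtraceD mxtraceZ. Qed.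
HB.instance Definition _ := GRing.isLinear.Build F 'End(V) F *%R (@ltr V) ltr_is_linear.

Lemma lmxE f i j : lmx f i j = coord (vbasis {:V}) j (f (vbasis {:V})`_i).
Proof. by rewrite /lmx mxE /= mxE vecof_delta. Qed.

Lemma ltrE f : ltr f = \sum_(i < \dim {:V}) coord (vbasis {:V}) i (f (vbasis {:V})`_i).
Proof. by apply: eq_bigr => i _; rewrite lmxE. Qed.
End OneSpace.
End LPoly.

Section Intertwine.
Variables (F : fieldType) (V W : vectType F).

Lemma lpoly_intertwine (h : 'Hom(V, W)) (f : 'End(V)) (g : 'End(W)) p :
  (forall v, h (f v) = g (h v)) -> forall v, h (lpoly p f v) = lpoly p g (h v).
Proof.
move=> H v; rewrite !lpolyE linear_sum; apply: eq_bigr => i _; rewrite linearZ; congr (_ *: _).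
by elim: (nat_of_ord i) => //= k IH; rewrite H IH.
Qed.
End Intertwine.

Lemma lpoly_commute (F : fieldType) (V : vectType F) (f : 'End(V)) p v :
  f (lpoly p f v) = lpoly p f (f v).
Proof. exact: lpoly_intertwine. Qed.

Lemma lpoly_comp (F : fieldType) (V : vectType F) (f : 'End(V)) p q v :
  lpoly p f (lpoly q f v) = lpoly q f (lpoly p f v).
Proof. by apply: lpoly_intertwine => w; rewrite lpoly_commute. Qed.

Section NilTrace.
Variable (C : closedFieldType).

Lemma mxtrace_nilpotent n (A : 'M[C]_n) k : A ^+ k = 0 -> \tr A = 0.
Proof.
move=> Ak; case: n => [|n] in A Ak *; first by rewrite /mxtrace big_ord0.
have [l Hl] := closed_field_poly_normal (char_poly A).
rewrite (eqP (char_poly_monic A)) scale1r in Hl.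
have l0 x : x \in l -> x = 0.
  move=> xl; have : root (char_poly A) x by rewrite Hl root_prod_XsubC.
  rewrite -eigenvalue_root_char => /eigenvalueP[v vA v0].
  have : v *m A ^+ k = x ^+ k *: v.
    elim: (k) => [|j IH]; first by rewrite !expr0 mulmx1 scale1r.
    by rewrite exprSr mulmxA IH -scalemxAl vA scalerA -exprSr.
  rewrite Ak mulmx0 => /esym/eqP; rewrite scaler_eq0 (negbTE v0) orbF.
  by rewrite expf_eq0 => /andP[_ /eqP].
have E : char_poly A = 'X ^+ size l.
  rewrite Hl; elim: l l0 {Hl} => [|x l IH] l0; first by rewrite big_nil expr0.
  have x0 : x = 0 by apply: l0; rewrite mem_head.
  rewrite big_cons IH => [|y yl]; last by apply: l0; rewrite inE yl orbT.
  by rewrite x0 polyC0 subr0 /= exprS.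
have := char_poly_trace A (ltn0Sn n).
have sl : size l = n.+1 by have := size_char_poly A; rewrite E size_polyXn => -[].
by rewrite E coefXn sl /= ltn_eqF // => /esym/eqP; rewrite oppr_eq0 => /eqP.
Qed.
End NilTrace.

(** * Functional calculus in a complex eigenbasis *)

Section Frame.
Local Open Scope complex_scope.
Variables (R : rcfType) (V : vectType R).
Local Notation C := R[i].
Local Notation toC := (real_complex R).
Local Notation n := (\dim {:V}).
Implicit Types (f g h : 'End(V)) (P : 'M[C]_n) (d : 'rV[C]_n) (phi : C -> C).

Definition cmx f : 'M[C]_n := map_mx toC (lmx f).

(* In the rows of P, which form a basis of the complexification, g is diagonal
   with entries phi d. *)
Definition acts P d phi g := P *m cmx g = diag_mx (map_mx phi d) *m P.

Definition conj_equivariant phi := forall x : C, phi (conjc x) = conjc (phi x).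

(** The third clause is a functional calculus with real polynomials; the fourth is the Jordan
    decomposition, [lpoly q f] being the semisimple part. *)
Definition lframe f P d := [/\ P \in unitmx,
    forall i, root (char_poly (cmx f)) (d 0 i),
    forall phi, conj_equivariant phi -> exists q : {poly R}, acts P d phi (lpoly q f) &
    exists q : {poly R}, acts P d id (lpoly q f) /\
      exists k, lfun_pow (f - lpoly q f) k = 0].

Lemma cmx_comp f g : cmx (f \o g)%VF = cmx g *m cmx f.
Proof. by rewrite /cmx lmx_comp map_mxM. Qed.
Lemma cmxD f g : cmx (f + g) = cmx f + cmx g.
Proof. by rewrite /cmx linearD map_mxD. Qed.
Lemma cmxB f g : cmx (f - g) = cmx f - cmx g.
Proof. by rewrite /cmx linearB map_mxB. Qed.
Lemma cmxZ a f : cmx (a *: f) = a%:C *: cmx f.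
Proof. by rewrite /cmx linearZ /= map_mxZ. Qed.
Lemma cmx0 : cmx 0 = 0. Proof. by rewrite /cmx linear0 map_mx0. Qed.
Lemma cmx_inj : injective cmx.
Proof. by move=> f g /map_mx_inj/lmx_inj. Qed.
Lemma cmx_pow f k : cmx (lfun_pow f k) = cmx f ^+ k.
Proof.
rewrite /cmx lmx_pow; elim: k => [|k IH]; first by rewrite !expr0 map_mx1.
by rewrite !exprS map_mxM IH.
Qed.

Lemma lframe_exists f : exists P d, lframe f P d.
Proof.
have H m (M : 'M[R]_m) : exists (P : 'M[C]_m) (d : 'rV[C]_m), [/\ P \in unitmx,
    forall i, root (char_poly (map_mx toC M)) (d 0 i),
    forall phi : C -> C, conj_equivariant phi ->
      exists q : {poly R},
        P *m map_mx toC (pmx q M) = diag_mx (map_mx phi d) *m P &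
    exists q : {poly R},
      P *m map_mx toC (pmx q M) = diag_mx d *m P /\
      exists k, (M - pmx q M) ^+ k = 0].
  case: m M => [|m] M.
    exists 1%:M, 0; split; first exact: unitmx1.
    - by case.
    - by move=> phi _; exists 0; apply/matrixP; case.
    by exists 0; split; [apply/matrixP; case | exists 0; apply/matrixP; case].
  have [P [d [Pu dr H1 [q [Hq [k Hk]]]]]] := spectral_poly M.
  exists P, d; split => //.
  - by move=> i; have := dr i; rewrite map_char_poly.
  - by move=> phi /H1[q' Hq']; exists q'; rewrite pmx_horner.
  by exists q; rewrite pmx_horner; split=> //; exists k.
have [P [d [Pu dr H1 [q [Hq [k Hk]]]]]] := H _ (lmx f).
exists P, d; split => //.
  by move=> phi /H1[q' Hq']; exists q'; rewrite /acts /cmx lmx_poly.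
exists q; rewrite /acts /cmx lmx_poly map_mx_id; split => //; exists k.
by apply: lmx_inj; rewrite lmx_pow linearB /= lmx_poly Hk linear0.
Qed.

Variables (f : 'End(V)) (P : 'M[C]_n) (d : 'rV[C]_n).
Hypothesis fr : lframe f P d.

Let Pu : P \in unitmx. Proof. by case: fr. Qed.

Lemma actsE phi g : acts P d phi g -> cmx g = invmx P *m diag_mx (map_mx phi d) *m P.
Proof. by rewrite /acts => E; rewrite -mulmxA -E mulKmx. Qed.

Lemma acts_inj phi psi g h : (forall i, phi (d 0 i) = psi (d 0 i)) ->
  acts P d phi g -> acts P d psi h -> g = h.
Proof.
move=> E /actsE Hg /actsE Hh; apply: cmx_inj.
have Ed : map_mx phi d = map_mx psi d.
  apply/rowP => i; rewrite mxE [in RHS]mxE; exact: E.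
rewrite Hg Hh Ed; reflexivity.
Qed.

Lemma acts_ext phi psi g : (forall i, phi (d 0 i) = psi (d 0 i)) ->
  acts P d phi g -> acts P d psi g.
Proof.
move=> E; rewrite /acts => ->; congr (diag_mx _ *m _).
by apply/rowP => i; rewrite !mxE E.
Qed.

Lemma acts0 : acts P d (fun=> 0) 0.
Proof.
rewrite /acts cmx0 mulmx0 (_ : map_mx _ d = 0) ?linear0 ?mul0mx //.
by apply/rowP => i; rewrite !mxE.
Qed.

Lemma actsD phi psi g h : acts P d phi g -> acts P d psi h ->
  acts P d (fun x => phi x + psi x) (g + h).
Proof.
move=> Hg Hh; rewrite /acts cmxD mulmxDr Hg Hh -mulmxDl -linearD; congr (diag_mx _ *m _).
by apply/rowP => i; rewrite !mxE.
Qed.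

Lemma actsZ phi a g : acts P d phi g -> acts P d (fun x => a%:C * phi x) (a *: g).
Proof.
move=> Hg; rewrite /acts cmxZ -scalemxAr Hg scalemxAl -linearZ /=; congr (diag_mx _ *m _).
by apply/rowP => i; rewrite !mxE.
Qed.

Lemma acts_comp phi psi g h : acts P d phi g -> acts P d psi h ->
  acts P d (fun x => phi x * psi x) (g \o h)%VF.
Proof.
move=> Hg Hh; rewrite /acts cmx_comp mulmxA Hh -mulmxA Hg mulmxA mulmx_diag.
by congr (diag_mx _ *m _); apply/rowP => i; rewrite !mxE mulrC.
Qed.

Lemma acts_tr phi g : acts P d phi g -> (ltr g)%:C = \sum_i phi (d 0 i).
Proof.
move=> /actsE E; rewrite /ltr -trace_map_mx -/(cmx g) E mxtrace_mulC mulmxA mulmxV // mul1mx.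
by rewrite mxtrace_diag; apply: eq_bigr => i _; rewrite mxE.
Qed.

(** A generalized eigenvector of f is also one of its semisimple part, as the two differ by a
    commuting nilpotent. *)
Lemma acts_geneigen phi g (v : 'rV[C]_n) a k : acts P d phi g ->
  v *m (cmx f - a%:M) ^+ k = 0 -> v *m cmx g = phi a *: v.
Proof.
case: fr => _ _ _ [q [HS [m Hm]]] Hg vk.
have idE : map_mx id d = d by apply/rowP => i; rewrite mxE.
rewrite /acts idE in HS.
have SM : cmx (lpoly q f) *m cmx f = cmx f *m cmx (lpoly q f).
  rewrite -!cmx_comp; congr cmx; apply/lfunP => w.
  by rewrite !comp_lfunE lpoly_commute.
apply: (geneigen_frame (k := (k + m)%N) Pu HS Hg).
rewrite -[cmx (lpoly q f)](subKr (cmx f)) -addrAC; apply: mulmx_exp_sub0 => //.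
  exact/esym/comm_mxB_scalar.
by rewrite -cmxB -cmx_pow Hm cmx0 mulmx0.
Qed.

Lemma ltr_nilpotent g k : lfun_pow g k = 0 -> ltr g = 0.
Proof.
move=> gk; apply: complexI; rewrite rmorph0 /ltr -trace_map_mx.
by apply: (@mxtrace_nilpotent _ _ _ k); rewrite -/(cmx g) -cmx_pow gk cmx0.
Qed.

Lemma lfun_pow_comp g h k : (forall v, g (h v) = h (g v)) ->
  lfun_pow (g \o h)%VF k = (lfun_pow g k \o lfun_pow h k)%VF.
Proof.
move=> gh; apply: lmx_inj; rewrite lmx_comp !lmx_pow lmx_comp; apply: exprMn_comm.
rewrite /GRing.comm -[LHS]/(_ *m _) -[RHS]/(_ *m _) -!lmx_comp; congr lmx.
by apply/lfunP => v; rewrite !comp_lfunE gh.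
Qed.

(** Only the semisimple part of f contributes: its nilpotent part composed with a polynomial in f is
    nilpotent and has trace 0. *)
Lemma acts_tr_comp phi p : acts P d phi (lpoly p f) ->
  (ltr (f \o lpoly p f)%VF)%:C = \sum_i d 0 i * phi (d 0 i).
Proof.
case: fr => _ _ _ [q [HS [m Hm]]] Hg.
have -> : (f \o lpoly p f = (lpoly q f \o lpoly p f) + ((f - lpoly q f) \o lpoly p f))%VF.
  by apply/lfunP => v; rewrite !(add_lfunE, comp_lfunE, opp_lfunE) [RHS]addrC subrK.
rewrite linearD /= (_ : ltr ((f - lpoly q f) \o lpoly p f)%VF = 0) ?addr0.
  by rewrite (acts_tr (acts_comp HS Hg)).
apply: (@ltr_nilpotent _ m); rewrite lfun_pow_comp ?Hm ?comp_lfun0l //.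
by move=> v; rewrite !(add_lfunE, opp_lfunE) linearB /= lpoly_commute lpoly_comp.
Qed.

Lemma acts_tr_sqr : (ltr (f \o f)%VF)%:C = \sum_i d 0 i ^+ 2.
Proof.
have [_ _ _ [q [HS [m Hm]]]] := fr.
have -> : (f \o f = (f \o lpoly q f) + ((f - lpoly q f) \o f))%VF.
  apply/lfunP => v; rewrite !(add_lfunE, comp_lfunE, opp_lfunE) lpoly_commute.
  by rewrite [RHS]addrC subrK.
rewrite linearD /= (_ : ltr ((f - lpoly q f) \o f)%VF = 0) ?addr0.
  by rewrite (acts_tr_comp HS); apply: eq_bigr => i _; rewrite expr2.
apply: (@ltr_nilpotent _ m); rewrite lfun_pow_comp ?Hm ?comp_lfun0l //.
by move=> v; rewrite !(add_lfunE, opp_lfunE) linearB /= lpoly_commute.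
Qed.

Lemma nilpotent_frame : (forall i, d 0 i = 0) -> lfun_nilpotent f.
Proof.
move=> d0; have [_ _ _ [q [HS [m Hm]]]] := fr; exists m.
have q0 : lpoly q f = 0 by apply: acts_inj HS acts0 => i.
by rewrite q0 subr0 in Hm.
Qed.

End Frame.

(** Let p interpolate z -> 1/z. Then f p(f) is a combination of positive powers of f, and its trace
    counts the non-zero eigenvalues; in characteristic 0 a vanishing count means that there are
    none. This takes the place of Newton's identities. *)
Lemma nilpotent_of_traces (R : rcfType) (V : vectType R) (f : 'End(V)) :
  (forall k, ltr (lfun_pow f k.+1) = 0) -> lfun_nilpotent f.
Proof.
move=> tr0; have [P [d fr]] := lframe_exists f.
have [_ _ H _] := fr.
have [p Hp] : exists p, acts P d (fun x => x^-1) (lpoly p f).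
  by apply: H => x; rewrite conjc_inv.
have := acts_tr_comp fr Hp.
have -> : ltr (f \o lpoly p f)%VF = 0.
  have -> : (f \o lpoly p f)%VF = \sum_(i < size p) p`_i *: lfun_pow f i.+1.
    apply/lfunP => v; rewrite comp_lfunE lpolyE linear_sum sum_lfunE.
    apply: eq_bigr => i _; rewrite linearZ scale_lfunE; congr (_ *: _).
    by rewrite lfun_powE.
  by rewrite linear_sum big1 // => i _; rewrite linearZ /= tr0 mulr0.
(* The convention that the inverse of 0 is 0 makes zero eigenvalues count for nothing. *)
have E i : d 0 i * (d 0 i)^-1 = (d 0 i != 0)%:R.
  by have [->|d0] := eqVneq (d 0 i); rewrite ?mul0r ?mulfV.
rewrite rmorph0 => /esym/eqP; rewrite psumr_eq0 => [/allP d0|i _]; last by rewrite E ler0n.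
apply: (nilpotent_frame fr) => i; have := d0 i (mem_index_enum _).
by rewrite E pnatr_eq0 eqb0 negbK => /eqP.
Qed.

(** * The real part of an endomorphism *)

Section RealPart.
Local Open Scope complex_scope.
Variables (R : rcfType) (V : vectType R).
Local Notation C := R[i].
Local Notation toC := (real_complex R).
Local Notation cRe := (fun x : C => (complex.Re x)%:C).

Lemma cRe_equivariant : conj_equivariant cRe.
Proof. by case=> a b /=; rewrite oppr0. Qed.

(* [q] evaluates at f to the operator acting on the generalized eigenspace of
   each eigenvalue z as multiplication by Re z. *)
Definition real_part_poly (f : 'End(V)) (q : {poly R}) :=
  exists P d, lframe f P d /\ acts P d cRe (lpoly q f).

Lemma real_part_exists f : exists q, real_part_poly f q.
Proof.
have [P [d fr]] := lframe_exists f; have [_ _ H _] := fr.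
by have [q Hq] := H _ cRe_equivariant; exists q, P, d.
Qed.

Variables (f : 'End(V)) (q : {poly R}).
Hypothesis Hq : real_part_poly f q.

(** [p] inverts the non-zero real parts and sends 0 to 0, so the real part composed with [lpoly p f]
    is the projector onto its image along its kernel. *)
Lemma real_part_split : exists p, forall x,
  lpoly q f (lpoly q f (lpoly p f x)) = lpoly q f x.
Proof.
have [P [d [fr Hr]]] := Hq; have [_ _ H _] := fr.
have [p Hp] : exists p, acts P d (fun x => ((complex.Re x)^-1)%:C) (lpoly p f).
  by apply: H; case=> a b /=; rewrite oppr0.
exists p => x; rewrite -!comp_lfunE; congr fun_of_lfun.
apply: (acts_inj fr _ (acts_comp (acts_comp Hr Hr) Hp) Hr) => i /=.
rewrite -!rmorphM /=; congr (_%:C).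
by have [->|a0] := eqVneq (complex.Re (d 0 i)) 0; rewrite ?mul0r // mulfK.
Qed.

(** Here [e a] evaluates at f to the projector onto the eigenvalues with real part a; it is a real
    polynomial because the indicator of Re z = a is invariant under conjugation. *)
Lemma real_part_eigen : exists (s : seq R) (e : R -> {poly R}),
  (forall x, lpoly q f x = \sum_(a <- s) a *: lpoly (e a) f x) /\
  forall a x, lpoly q f (lpoly (e a) f x) = a *: lpoly (e a) f x.
Proof.
have [P [d [fr Hr]]] := Hq; have [_ _ H _] := fr.
pose phi a (z : C) : C := (complex.Re z == a)%:R.
have /boolp.choice[e He] : forall a, exists p, acts P d (phi a) (lpoly p f).
  move=> a; apply: H; case=> x y; rewrite /phi /=.
  by rewrite rmorph_nat.
exists (undup [seq complex.Re (d 0 i) | i : 'I__]), e; split=> [x|a x].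
  pose s := undup [seq complex.Re (d 0 i) | i : 'I_(\dim {:V})]; rewrite -/s.
  have -> : lpoly q f = \sum_(a <- s) a *: lpoly (e a) f.
    have Hs (l : seq R) : acts P d (fun z => \sum_(a <- l) a%:C * phi a z)
        (\sum_(a <- l) a *: lpoly (e a) f).
      elim: l => [|a l IH].
        by rewrite big_nil; apply: (acts_ext (phi := fun=> 0)); [move=> i; rewrite big_nil | exact: acts0].
      rewrite big_cons; apply: (acts_ext (phi := fun z => a%:C * phi a z + \sum_(b <- l) b%:C * phi b z)).
        by move=> i; rewrite big_cons.
      by apply: actsD => //; apply: actsZ.
    apply: (acts_inj fr _ Hr (Hs s)) => i /=.
    rewrite (bigD1_seq (complex.Re (d 0 i))) ?undup_uniq //=; last first.
      by rewrite mem_undup; exact: (map_f (fun i => complex.Re (d 0 i))) (mem_enum _ i).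
    rewrite /phi eqxx mulr1 big1 ?addr0 // => a; rewrite eq_sym => /negbTE ->.
    by rewrite mulr0.
  by rewrite sum_lfunE; apply: eq_bigr => a _; rewrite scale_lfunE.
rewrite -comp_lfunE -scale_lfunE; congr fun_of_lfun.
apply: (acts_inj fr _ (acts_comp Hr (He a)) (actsZ a (He a))) => i /=.
by rewrite /phi; have [->|] := eqVneq; rewrite ?mulr0.
Qed.

(** The real part of the first trace is the sum of the (Re d_i)^2, so the eigenvalues are imaginary;
    the second trace is then minus the sum of the (Im d_i)^2. *)
Lemma real_part_nilpotent : ltr (f \o lpoly q f)%VF = 0 ->
  ltr (f \o f)%VF = 0 -> lfun_nilpotent f.
Proof.
have [P [d [fr Hr]]] := Hq => t1 t2.
have := acts_tr_comp fr Hr; rewrite t1 rmorph0 => E1.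
have {E1} re0 i : complex.Re (d 0 i) = 0.
  have /eqP : \sum_i (complex.Re (d 0 i)) ^+ 2 = 0.
    have := congr1 (@complex.Re R) E1; rewrite raddf_sum /= => E; rewrite [RHS]E.
    by apply: eq_bigr => j _; case: (d 0 j) => a b; rewrite /= mulr0 subr0 expr2.
  rewrite psumr_eq0 => [/allP/(_ i (mem_index_enum _))|j _]; last exact: sqr_ge0.
  by rewrite sqrf_eq0 => /eqP.
have := acts_tr_sqr fr; rewrite t2 rmorph0 => E2.
apply: (nilpotent_frame fr) => i.
have /eqP : \sum_i (complex.Im (d 0 i)) ^+ 2 = 0.
  have := congr1 (@complex.Re R) E2; rewrite raddf_sum /= => /eqP.
  rewrite eq_sym -oppr_eq0 -sumrN => /eqP E; rewrite -[RHS]E.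
  apply: eq_bigr => j _; have := re0 j; case: (d 0 j) => a b /= ->.
  by rewrite mul0r sub0r opprK expr2.
rewrite psumr_eq0 => [/allP/(_ i (mem_index_enum _))|j _]; last exact: sqr_ge0.
by rewrite sqrf_eq0 => /eqP; have := re0 i; case: (d 0 i) => a b /= -> ->.
Qed.

(** [h] embeds W as an f-stable subspace on which the real part vanishes. Eigenvectors of f' go to
    eigenvectors of f, so the eigenvalues of f' are imaginary and their squares are at most 0. *)
Lemma real_part0_tr_le0 (W : vectType R) (f' : 'End(W)) (h : 'Hom(W, V)) :
  injective h -> (forall x, h (f' x) = f (h x)) ->
  (forall x, lpoly q f (h x) = 0) -> ltr (f' \o f')%VF <= 0.
Proof.
move=> inj_h hf rho0; have [P [d [fr Hr]]] := Hq.
have [P' [d' fr']] := lframe_exists f'; have [_ rt _ _] := fr'.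
pose J := map_mx toC (mxof (vbasis {:W}) (vbasis {:V}) h).
have JE : cmx f' *m J = J *m cmx f.
  rewrite /cmx /J /lmx -!map_mxM -(mxof_comp _ _ (vbasisP _)) -(mxof_comp _ _ (vbasisP _)).
  by congr (map_mx _ (mxof _ _ _)); apply/lfunP => x; rewrite !comp_lfunE hf.
have Jf : row_free J.
  rewrite /J row_free_map; apply/row_freeP.
  exists (mxof (vbasis {:V}) (vbasis {:W}) (h^-1)%VF).
  rewrite -(mxof_comp _ _ (vbasisP _)) lker0_compVf ?mxof1 ?(basis_free (vbasisP _)) //.
  exact/lker0P.
have re0 i : complex.Re (d' 0 i) = 0.
  have := rt i; rewrite -eigenvalue_root_char => /eigenvalueP[u uf u0].
  have g : (u *m J) *m (cmx f - (d' 0 i)%:M) ^+ 1 = 0.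
    rewrite expr1 mulmxBr -mulmxA -JE mulmxA uf mul_mx_scalar -scalemxAl subrr //.
  have := acts_geneigen fr Hr g; rewrite -mulmxA.
  have -> : J *m cmx (lpoly q f) = 0.
    rewrite /cmx /J /lmx -map_mxM -(mxof_comp _ _ (vbasisP _)).
    rewrite (_ : (_ \o _)%VF = 0) ?linear0 ?map_mx0 //.
    by apply/lfunP => x; rewrite comp_lfunE rho0 zero_lfunE.
  rewrite mulmx0 => /esym/eqP; rewrite scaler_eq0 => /orP[/eqP/complexI //|].
  by rewrite -(mul0mx _ J) (inj_eq (row_free_inj Jf)) (negbTE u0).
rewrite -lecR (acts_tr_sqr fr') rmorph0; apply: sumr_le0 => i _.
have := re0 i; case: (d' 0 i) => a b /= ->.
by rewrite expr2 /= lecE /= !mul0r mulr0 !addr0 eqxx /= sub0r oppr_le0 -expr2 sqr_ge0.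
Qed.
End RealPart.

(** * Derivations of Lie algebras *)

Section LieBasics.
Variables (F : fieldType) (g : lieAlgType F).
Implicit Types (x y z : g) (U I J : {vspace g}).

Lemma lieDr x y z : lie x (y + z) = lie x y + lie x z. Proof. exact: linearD. Qed.
Lemma lieZr a x y : lie x (a *: y) = a *: lie x y. Proof. exact: linearZ. Qed.
Lemma lieNr x y : lie x (- y) = - lie x y. Proof. exact: linearN. Qed.
Lemma lie0r x : lie x 0 = 0. Proof. exact: linear0. Qed.
Lemma lieDl x y z : lie (x + y) z = lie x z + lie y z.
Proof. by have := lie_bilinear_subproof.1 z 1 x y; rewrite scale1r => -> /=; rewrite -[1 *: _]/(1 *: lie x z) scale1r. Qed.

Lemma lieC x y : lie x y = - lie y x.
Proof.
apply/eqP; rewrite -addr_eq0; have := liexx (x + y).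
by rewrite lieDl !lieDr !liexx add0r addr0 => ->.
Qed.

Lemma lieZl a x y : lie (a *: x) y = a *: lie x y.
Proof. by rewrite lieC lieZr -scalerN -lieC. Qed.
Lemma lieNl x y : lie (- x) y = - lie x y.
Proof. by rewrite lieC lieNr -lieC. Qed.
Lemma lie0l x : lie 0 x = 0. Proof. by rewrite lieC lie0r oppr0. Qed.
Lemma lieBl x y z : lie (x - y) z = lie x z - lie y z. Proof. by rewrite lieDl lieNl. Qed.
Lemma lieBr x y z : lie x (y - z) = lie x y - lie x z. Proof. by rewrite lieDr lieNr. Qed.

Lemma lie_derivation x y z : lie x (lie y z) = lie (lie x y) z + lie y (lie x z).
Proof.
have := lie_jacobi x y z; rewrite -addrA => /eqP; rewrite addr_eq0 => /eqP ->.
by rewrite [lie z (lie x y)]lieC [lie z x]lieC lieNr opprD !opprK addrC.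
Qed.

Lemma adE x y : ad x y = lie x y. Proof. by rewrite lfunE. Qed.

Lemma ad_is_linear : linear (@ad F g).
Proof.
by move=> a x y; apply/lfunP => z; rewrite add_lfunE scale_lfunE !adE lieDl lieZl.
Qed.
HB.instance Definition _ := GRing.isLinear.Build F g 'End(g) _ (@ad F g) ad_is_linear.

Lemma ad_lie x y : ad (lie x y) = (ad x \o ad y)%VF - (ad y \o ad x)%VF.
Proof.
apply/lfunP => z; rewrite add_lfunE opp_lfunE !comp_lfunE !adE.
by rewrite [lie x (lie y z)]lie_derivation addrK.
Qed.

Definition derivation (f : 'End(g)) := forall x y, f (lie x y) = lie (f x) y + lie x (f y).

Lemma derivation_ad x : derivation (ad x).
Proof. by move=> y z; rewrite !adE lie_derivation. Qed.

Lemma derivation_adP f : derivation f <->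
  forall x, ad (f x) = (f \o ad x)%VF - (ad x \o f)%VF.
Proof.
split=> [H x|H x y].
  by apply/lfunP => y; rewrite add_lfunE opp_lfunE !comp_lfunE !adE H addrK.
have /lfunP/(_ y) := H x; rewrite add_lfunE opp_lfunE !comp_lfunE !adE => ->.
by rewrite subrK.
Qed.

Lemma mem_lie_span U I x y : x \in U -> y \in I -> lie x y \in lie_span U I.
Proof.
move=> /coord_vbasis -> /coord_vbasis ->.
have suml (V : finType) (a : V -> F) (X : V -> g) z :
    lie (\sum_i a i *: X i) z = \sum_i a i *: lie (X i) z.
  rewrite lieC linear_sum -sumrN; apply: eq_bigr => i _.
  by rewrite /= lieZr -scalerN -lieC.
rewrite suml memv_suml // => i _; rewrite memvZ // linear_sum memv_suml // => j _.
rewrite /= lieZr memvZ // memv_span //; apply/allpairsP.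
by exists ((vbasis U)`_i, (vbasis I)`_j); rewrite !mem_nth ?size_tuple.
Qed.

Lemma lie_span_sub U I J :
  reflect {in U & I, forall x y, lie x y \in J} (lie_span U I <= J)%VS.
Proof.
apply: (iffP idP) => [/subvP H x y xU yI|H]; first by apply: H; apply: mem_lie_span.
apply/span_subvP => z /allpairsP[[x y] /= [xU yI ->]].
by apply: H; apply: vbasis_mem.
Qed.

Lemma lie_span_sumP U I z : z \in lie_span U I ->
  exists s : seq (g * g), (forall p, p \in s -> p.1 \in U /\ p.2 \in I) /\
    z = \sum_(p <- s) lie p.1 p.2.
Proof.
rewrite /lie_span; set X := [seq lie x y | x <- vbasis U, y <- vbasis I].
have HX v : v \in X -> exists x y, [/\ x \in U, y \in I & v = lie x y].
  case/allpairsP=> [[x y] /= [xU yI ->]]; exists x, y.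
  by split => //; apply: vbasis_mem.
elim: X HX z => [|v X IH] HX z.
  by rewrite span_nil memv0 => /eqP ->; exists [::]; rewrite big_nil.
rewrite span_cons => /memv_addP[_ /vlineP[a ->] [w wX ->]].
have [|s [sUI ->]] := IH _ w wX; first by move=> t tX; apply: HX; rewrite inE tX orbT.
have [x [y [xU yI ->]]] := HX v (mem_head _ _).
exists ((a *: x, y) :: s); rewrite big_cons lieZl; split => // p.
by rewrite inE => /orP[/eqP -> /=|/sUI //]; rewrite memvZ.
Qed.

Lemma lie_spanS U U' I I' : (U <= U')%VS -> (I <= I')%VS ->
  (lie_span U I <= lie_span U' I')%VS.
Proof.
move=> /subvP UU /subvP II; apply/lie_span_sub => x y xU yI.
by apply: mem_lie_span; [apply: UU | apply: II].
Qed.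

Lemma lie_idealP U I x y : lie_ideal U I -> x \in U -> y \in I -> lie x y \in I.
Proof. by case=> _ H; apply: H. Qed.
Lemma lie_idealPr U I x y : lie_ideal U I -> x \in I -> y \in U -> lie x y \in I.
Proof. by move=> H xI yU; rewrite lieC memvN (lie_idealP H). Qed.

Lemma lie_ideal_span U I J : lie_ideal U I -> lie_ideal U J -> lie_ideal U (lie_span I J).
Proof.
move=> HI HJ; split.
  apply/lie_span_sub => x y xI yJ; apply: (subvP HJ.1); apply: (lie_idealP HJ) => //.
  exact: (subvP HI.1).
move=> x y xU /lie_span_sumP [s [sIJ ->]].
rewrite linear_sum big_seq memv_suml // => p /sIJ [p1 p2] /=.
rewrite lie_derivation memvD // mem_lie_span //; first exact: (lie_idealP HI).
exact: (lie_idealP HJ).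
Qed.

Lemma lie_ideal_add U I J : lie_ideal U I -> lie_ideal U J -> lie_ideal U (I + J).
Proof.
move=> HI HJ; split; first by rewrite subv_add HI.1 HJ.1.
move=> x y xU /memv_addP[i iI [j jJ ->]]; rewrite lieDr memv_add //.
  exact: (lie_idealP HI).
exact: (lie_idealP HJ).
Qed.

Lemma lie_ideal_full U : lie_subalgebra U -> lie_ideal U U.
Proof. by move=> H; split. Qed.

Lemma lie_ideal0 U : lie_ideal U 0.
Proof. by split; rewrite ?sub0v // => x y _; rewrite memv0 => /eqP->; rewrite lie0r mem0v. Qed.

End LieBasics.

Section FrameLie.
Variables (R : rcfType) (g : lieAlgType R).
Local Notation C := (complex R).
Local Notation toC := (real_complex R).

(** Being a derivation is a matrix identity involving the [ad] of a real basis. Read with complex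
    entries it is [derivation_mx], which spares the construction of a complex Lie algebra. *)
Lemma acts_derivation (f : 'End(g)) P d (phi : C -> C) q : lframe f P d ->
  derivation f -> {morph phi : x y / x + y} -> acts P d phi (lpoly q f) ->
  derivation (lpoly q f).
Proof.
move=> fr df phiD Hq; have [Pu _ _ [q0 [HS [m Hm]]]] := fr.
pose e := vbasis {:g}.
pose A (i : 'I_(\dim {:g})) : 'M[C]_(\dim {:g}) := cmx (ad e`_i).
have eb : basis_of {:g} e := vbasisP _.
have fe (h : 'End(g)) (i : 'I_(\dim {:g})) : h e`_i = \sum_k lmx h i k *: e`_k.
  rewrite [LHS](coord_basis eb) ?memvf //; apply: eq_bigr => k _.
  by rewrite lmxE.
have dmx h : derivation_mx A (cmx h) <-> derivation h.
  have E (i : 'I_(\dim {:g})) : cmx (ad (h e`_i)) = \sum_k cmx h i k *: A k.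
    rewrite fe linear_sum /cmx linear_sum map_mx_sum; apply: eq_bigr => k _.
    by rewrite !linearZ /= map_mxZ; congr (_ *: _); rewrite [RHS]mxE.
  split=> [H|/derivation_adP H i]; last first.
    apply/eqP; rewrite addrC -subr_eq -E H cmxB !cmx_comp //.
  have He (i : 'I_(\dim {:g})) : ad (h e`_i) = (h \o ad e`_i)%VF - (ad e`_i \o h)%VF.
    by apply: cmx_inj; rewrite E cmxB !cmx_comp H [X in _ = X - _]addrC addrK.
  apply/derivation_adP => x; rewrite (coord_basis eb (memvf x)) !linear_sum /=.
  apply/lfunP => y; rewrite add_lfunE opp_lfunE !comp_lfunE !sum_lfunE linear_sum -sumrB.
  apply: eq_bigr => i _; rewrite !linearZ /= !scale_lfunE !linearZ /= -scalerDr; congr (_ *: _).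
  by rewrite He add_lfunE opp_lfunE !comp_lfunE.
apply/dmx; move/dmx: df => df.
have idE : map_mx id d = d by apply/rowP => i; rewrite mxE.
rewrite /acts idE in HS.
apply: (frame_derivation (m := m) Pu _ _ df phiD HS Hq).
  rewrite -!cmx_comp; congr cmx; apply/lfunP => w.
  by rewrite !comp_lfunE lpoly_commute.
by rewrite -cmxB -cmx_pow Hm cmx0.
Qed.

Lemma real_part_derivation (f : 'End(g)) q : real_part_poly f q ->
  derivation f -> derivation (lpoly q f).
Proof.
case=> P [d [fr Hr]] df; apply: (acts_derivation fr df _ Hr) => x y.
by rewrite -rmorphD raddfD.
Qed.

(** The last two clauses record what is used of the semisimple part later: it vanishes on the
    generalized null space of f, and it is diagonalisable over the complex numbers. *)
Lemma jordan_derivation (f : 'End(g)) : derivation f -> exists q, [/\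
  derivation (lpoly q f), lfun_nilpotent (f - lpoly q f),
  forall k x, lfun_pow f k x = 0 -> lpoly q f x = 0 &
  exists P d, P \in unitmx /\ P *m cmx (lpoly q f) = diag_mx d *m P].
Proof.
move=> df; have [P [d fr]] := lframe_exists f.
have [Pu _ _ [q [HS Hm]]] := fr; exists q; split => //.
- exact: (acts_derivation fr df _ HS).
- move=> k x fx; pose v := map_mx toC (rVof (vbasis {:g}) x).
  have vk : v *m (cmx f - 0%:M) ^+ k = 0.
    rewrite (_ : 0%:M = 0) ?subr0; last by apply/matrixP => i j; rewrite !mxE mul0rn.
    by rewrite -cmx_pow -map_mxM -(rVof_app _ (vbasisP _)) fx linear0 map_mx0.
  have := acts_geneigen fr HS vk; rewrite scale0r -map_mxM -(rVof_app _ (vbasisP _)).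
  move=> H; apply/eqP; rewrite -(rVof_eq0 (vbasisP _)); apply/eqP.
  by apply: (map_mx_inj (f := toC)); rewrite H map_mx0.
exists P, d; split => //; move: HS; rewrite /acts (_ : map_mx id d = d) //.
by apply/rowP => i; rewrite mxE.
Qed.
End FrameLie.

(** * Engel's theorem and Cartan's criterion *)

Lemma exists_maximal_vspace (F : fieldType) (V : vectType F) (P : {vspace V} -> Prop) U0 :
  P U0 -> exists U, P U /\ forall U', P U' -> (U <= U')%VS -> (U' <= U)%VS.
Proof.
have [m Hm] := ubnP (\dim {:V} - \dim U0); elim: m U0 Hm => // m IH U0 Hm PU.
have [H|/boolp.existsNP[U' /boolp.not_implyP[PU' /boolp.not_implyP[UU' /negP nU]]]] :=
  boolp.pselect (forall U', P U' -> (U0 <= U')%VS -> (U' <= U0)%VS).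
  by exists U0.
apply: (IH U') => //; apply: leq_trans (_ : (\dim {:V} - \dim U' < \dim {:V} - \dim U0)%N) _; last by rewrite -ltnS.
have lt : (\dim U0 < \dim U')%N.
  by rewrite ltn_neqAle (dimvS UU') andbT (dimv_leqif_sup UU').2.
by rewrite ltn_sub2l // (leq_trans lt) // dimvS // subvf.
Qed.

Section Engel.
Variables (F : fieldType) (g : lieAlgType F).
Implicit Types (L M N I V : {vspace g}).

(** The series measures the action of M on the whole of g, not on M: the k-th term is spanned by the
    k-fold brackets of elements of M with g. *)
Definition lower_series M k : {vspace g} := iter k (lie_span M) fullv.

Definition acts_nilpotently M := exists k, lower_series M k = 0%VS.

Lemma lie_span0l V : lie_span (0 : {vspace g}) V = 0%VS.
Proof.
apply/eqP; rewrite -subv0; apply/lie_span_sub => x y; rewrite memv0 => /eqP -> _.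
by rewrite lie0l mem0v.
Qed.

Lemma lie_span0r V : lie_span V (0 : {vspace g}) = 0%VS.
Proof.
apply/eqP; rewrite -subv0; apply/lie_span_sub => x y _; rewrite memv0 => /eqP ->.
by rewrite lie0r mem0v.
Qed.

Lemma iter_lie_spanS M k V W : (V <= W)%VS ->
  (iter k (lie_span M) V <= iter k (lie_span M) W)%VS.
Proof. by move=> VW; elim: k => //= k IH; apply: lie_spanS. Qed.

Lemma lower_series_decr M k : (lower_series M k.+1 <= lower_series M k)%VS.
Proof. by rewrite /lower_series iterSr; apply: iter_lie_spanS; rewrite subvf. Qed.

Lemma lower_series_stable M x k v : (forall m, m \in M -> lie x m \in M) ->
  v \in lower_series M k -> lie x v \in lower_series M k.
Proof.
move=> xM; elim: k v => [|k IH] v /=; first by rewrite !memvf.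
case/lie_span_sumP => s [Hs ->]; rewrite linear_sum big_seq memv_suml // => p /Hs[p1 p2] /=.
by rewrite lie_derivation memvD // mem_lie_span ?xM ?IH.
Qed.

Lemma lower_series_ideal N k : lie_ideal fullv N -> lie_ideal fullv (lower_series N k).
Proof.
move=> HN; split; first exact: subvf.
by move=> x y _; apply: lower_series_stable => m mN; apply: (lie_idealP HN); rewrite ?memvf.
Qed.

(** Modulo the next term of the series, i brackets with M + <x> only produce the image of the i-th
    power of [ad x]. So p brackets descend one term, and p * k of them reach 0. *)
Lemma acts_nilpotently_add_line M x : lie_subalgebra M ->
  (forall m, m \in M -> lie x m \in M) -> acts_nilpotently M ->
  lfun_nilpotent (ad x) -> acts_nilpotently (M + <[x]>)%VS.
Proof.
move=> subM xM [k Hk] [p Hp].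
have step j i : (iter i (lie_span (M + <[x]>)) (lower_series M j)
    <= lower_series M j.+1 + lfun_pow (ad x) i @: lower_series M j)%VS.
  elim: i => [|i IH]; first by rewrite /= lim1g addvSr.
  rewrite iterS; apply/lie_span_sub => y z /memv_addP[m mM [_ /vlineP[a ->] ->]].
  move/(subvP IH)/memv_addP => [u uV [_ /memv_imgP[w wV ->] ->]].
  rewrite lieDl !lieDr addrA; apply: memv_add.
    have xk : lfun_pow (ad x) i w \in lower_series M j.
      rewrite lfun_powE; elim: (i) => //= i' IHi; rewrite adE.
      exact: lower_series_stable.
    rewrite !memvD //.
    - exact/(subvP (lower_series_decr _ _))/mem_lie_span.
    - exact: mem_lie_span.
    by rewrite lieZl memvZ // lower_series_stable.
  by rewrite lieZl -lieZr -linearZ /= -adE -comp_lfunE -lfun_powS memv_img // memvZ.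
exists (p * k)%N; apply/eqP; rewrite -subv0 -Hk.
elim: (k) => [|j IH]; first by rewrite muln0.
rewrite /lower_series mulnS iterD; apply: subv_trans (iter_lie_spanS _ _ IH) _.
by apply: subv_trans (step _ _) _; rewrite Hp lim0g addv0.
Qed.

(** Take M maximal among the subalgebras of L that act nilpotently. If M is proper, some x of L
    outside M normalises M, and adding x contradicts maximality. *)
Lemma engel L : lie_subalgebra L -> {in L, forall x, lfun_nilpotent (ad x)} ->
  acts_nilpotently L.
Proof.
move=> subL nilL.
pose P M := [/\ (M <= L)%VS, lie_subalgebra M & acts_nilpotently M].
have P0 : P 0%VS.
  split; first exact: sub0v.
    by move=> x y; rewrite memv0 => /eqP-> _; rewrite lie0l mem0v.
  by exists 1%N; rewrite /lower_series /= lie_span0l.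
have [M [[ML subM nilM] maxM]] := exists_maximal_vspace P0.
have [LM|] := boolP (L <= M)%VS; first by rewrite (_ : L = M) //; apply: subv_anti; rewrite LM.
case/subvPn=> x0 x0L x0M; exfalso.
have [[x [xL xM Hx]]|H] := boolp.pselect
    (exists x, [/\ x \in L, x \notin M & forall m, m \in M -> lie x m \in M]).
  have /maxM : P (M + <[x]>)%VS.
    split.
    - by rewrite subv_add ML -memvE.
    - move=> _ _ /memv_addP[m mM [_ /vlineP[a ->] ->]] /memv_addP[n nM [_ /vlineP[b ->] ->]].
      apply: (subvP (addvSl _ _)); rewrite lieDl !lieDr !lieZl !lieZr liexx !scaler0 addr0.
      have mx : lie m x \in M by rewrite lieC memvN Hx.
      have mn : lie m n \in M by apply: subM.
      by rewrite !memvD ?memvZ ?mx ?Hx ?mn.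
    by apply: acts_nilpotently_add_line => //; apply: nilL.
  by move/(_ (addvSl _ _)); rewrite subv_add -memvE (negbTE xM) andbF.
have [k Hk] := nilM.
(* Without such an x, elements of L outside M would occur in every term of the series, including the
   zero term. *)
have : exists x, [/\ x \in L, x \notin M & x \in lower_series M k].
  elim: {Hk} k => [|k [x [xL xM xV]]]; first by exists x0; rewrite memvf.
  have [y [yM xy]] : exists y, y \in M /\ lie y x \notin M.
    apply: boolp.contrapT => Hy; apply: H; exists x; split => // m mM.
    apply: boolp.contrapT => /negP xm; apply: Hy; exists m; split => //.
    by rewrite lieC memvN.
  by exists (lie y x); split => //; [apply: subL => //; apply: (subvP ML) | apply: mem_lie_span].
by case=> x [_ xM]; rewrite Hk memv0 => /eqP x0'; rewrite x0' mem0v in xM.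
Qed.
End Engel.

(** * Nilpotent action from traces *)

Section SolvableIdeal.
Variables (R : rcfType) (g : lieAlgType R).
Implicit Types (N P Q I : {vspace g}) (w : 'End(g)).

Definition stabilizes_ideals w :=
  forall I, lie_ideal fullv I -> forall v, v \in I -> w v \in I.

(** The terms of the lower series of N are ideals, preserved by w, and [ad x] descends one term; the
    composite is nilpotent. *)
Lemma ltr_nilpotent_ideal N w x : lie_ideal fullv N -> acts_nilpotently N ->
  stabilizes_ideals w -> x \in N -> ltr (ad x \o w)%VF = 0.
Proof.
move=> HN [k Hk] wI xN; apply: (@ltr_nilpotent _ _ _ k).
apply/lfunP => v; rewrite zero_lfunE; apply/eqP; rewrite -memv0 -Hk lfun_powE.
elim: k {Hk} => [|k IH] /=; first by rewrite memvf.
rewrite comp_lfunE adE mem_lie_span // wI //.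
exact: lower_series_ideal.
Qed.

Lemma stabilizes_ideals_comp w1 w2 : stabilizes_ideals w1 -> stabilizes_ideals w2 ->
  stabilizes_ideals (w1 \o w2)%VF.
Proof. by move=> H1 H2 I HI v vI; rewrite comp_lfunE; apply/H1/H2. Qed.

Lemma stabilizes_ideals_ad x : stabilizes_ideals (ad x).
Proof. by move=> I HI v vI; rewrite adE (lie_idealP HI) ?memvf. Qed.

(** Moving [ad x] past the factors [ad y] one at a time leaves terms containing [ad (lie x y)], each
    of trace 0 since [lie x y] lies in N. *)
Lemma ltr_commutator_pow N w x y k : lie_ideal fullv N -> acts_nilpotently N ->
  stabilizes_ideals w -> lie x y \in N ->
  ltr (w \o ((ad x \o lfun_pow (ad y) k) - (lfun_pow (ad y) k \o ad x)))%VF = 0.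
Proof.
move=> HN nilN + xyN; elim: k w => [|k IH] w wI.
  by rewrite /lfun_pow /= comp_lfun1l comp_lfun1r subrr comp_lfun0r linear0.
set W := lfun_pow (ad y) k in IH *; rewrite lfun_powS -/W.
have -> : (w \o ((ad x \o (ad y \o W)) - ((ad y \o W) \o ad x)))%VF =
  (w \o (ad (lie x y) \o W))%VF + ((w \o ad y) \o ((ad x \o W) - (W \o ad x)))%VF.
  rewrite ad_lie; apply/lfunP => v.
  rewrite !(comp_lfunE, add_lfunE, opp_lfunE) -[RHS]linearD /=; congr (w _).
  by rewrite [in RHS]linearB addrA subrK.
rewrite linearD /= IH ?addr0; last exact: (stabilizes_ideals_comp wI (stabilizes_ideals_ad _)).
rewrite ltr_comp -comp_lfunA; apply: (ltr_nilpotent_ideal HN nilN) => //.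
apply: stabilizes_ideals_comp => // I HI v vI.
rewrite lfun_powE; elim: (k) => //= j IHj.
exact: stabilizes_ideals_ad.
Qed.

(** For y in the sum, the trace of (ad y)^(k+1) reduces to traces of [ad p, ad q] (ad y)^k, that is
    of ad p [ad q, (ad y)^k], and these vanish because [q, y] lies in N. Nilpotency of each [ad y]
    follows, and Engel's theorem concludes. *)
Lemma acts_nilpotently_add_bracket N P Q : lie_ideal fullv N -> acts_nilpotently N ->
  lie_ideal fullv P -> lie_ideal fullv Q ->
  {in Q & lie_span P Q, forall x y, lie x y \in N} ->
  acts_nilpotently (lie_span P Q + N)%VS.
Proof.
move=> HN nilN HP HQ H.
have HPQ : lie_ideal fullv (lie_span P Q + N)%VS.
  by apply: lie_ideal_add => //; apply: lie_ideal_span.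
apply: engel => [x y _|y]; first by apply: (lie_idealP HPQ); rewrite memvf.
case/memv_addP=> c cPQ [n nN def_y]; apply: nilpotent_of_traces => k.
have yN q : q \in Q -> lie q y \in N.
  move=> qQ; rewrite def_y lieDr; apply: memvD; first exact: H.
  by rewrite (lie_idealP HN) ?memvf.
have powI : stabilizes_ideals (lfun_pow (ad y) k).
  move=> I HI v vI; rewrite lfun_powE; elim: (k) => //= j; exact: stabilizes_ideals_ad.
rewrite lfun_powS {1}def_y linearD /= comp_lfunDl linearD /=.
rewrite (ltr_nilpotent_ideal HN nilN powI nN) addr0.
have [s [Hs ->]] := lie_span_sumP cPQ.
rewrite linear_sum big_seq; elim/big_rec: _ => [|p e /Hs[pP pQ] IH].
  by rewrite comp_lfun0l linear0.
rewrite comp_lfunDl linearD /= IH addr0 ad_lie.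
have -> : (((ad p.1 \o ad p.2) - (ad p.2 \o ad p.1)) \o lfun_pow (ad y) k)%VF =
   (ad p.1 \o (ad p.2 \o lfun_pow (ad y) k))%VF - (ad p.2 \o (ad p.1 \o lfun_pow (ad y) k))%VF.
  by apply/lfunP => v; rewrite !(comp_lfunE, add_lfunE, opp_lfunE).
rewrite linearB /= [X in _ - X]ltr_comp -linearB /= -comp_lfunA.
rewrite -[RHS](ltr_commutator_pow (x := p.2) (y := y) k HN nilN (stabilizes_ideals_ad p.1) (yN _ pQ)).
congr ltr; apply/lfunP => v.
by rewrite !(comp_lfunE, add_lfunE, opp_lfunE) linearB.
Qed.

Lemma lie_ideal_derived I k : lie_ideal fullv I -> lie_ideal fullv (derived_series I k).
Proof. by move=> HI; elim: k => //= k IH; apply: lie_ideal_span. Qed.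

(** Induction up the derived series from its zero term. For a term B, the hypothesis on [B, B]
    allows [B, B] to be added to N; as [B, [g, B]] lies in [B, B], a second application adds
    [g, B]. *)
Theorem solvable_ideal_bracket_nilpotent I : lie_ideal fullv I -> lie_solvable I ->
  exists N, [/\ lie_ideal fullv N, acts_nilpotently N & (lie_span fullv I <= N)%VS].
Proof.
move=> HI [m Hm].
have full_ideal : lie_ideal fullv (fullv : {vspace g}).
  by split => [|? ? _ _]; rewrite ?subvv ?memvf.
suff H j : (j <= m)%N -> exists N, [/\ lie_ideal fullv N, acts_nilpotently N &
    (lie_span fullv (derived_series I (m - j)) <= N)%VS].
  by have := H m (leqnn m); rewrite subnn.
elim: j => [_|j IH jm].
  exists 0%VS; rewrite subn0 Hm lie_span0r; split => //; first exact: lie_ideal0.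
  by exists 1%N; rewrite /lower_series /= lie_span0l.
have [N [HN nilN DN]] := IH (ltnW jm).
set B := derived_series I (m - j.+1).
have E : derived_series I (m - j) = lie_span B B by rewrite -subnSK.
rewrite E in DN.
have HB : lie_ideal fullv B by apply: lie_ideal_derived.
have nilN1 : acts_nilpotently (lie_span B B + N)%VS.
  apply: acts_nilpotently_add_bracket => // x y xB yBB.
  by apply: (subvP DN); apply: mem_lie_span; rewrite ?memvf.
have HN1 : lie_ideal fullv (lie_span B B + N)%VS.
  by apply: lie_ideal_add => //; apply: lie_ideal_span.
exists (lie_span fullv B + (lie_span B B + N))%VS; split.
- by apply: lie_ideal_add => //; apply: lie_ideal_span.
- apply: acts_nilpotently_add_bracket => // x y xB yB.
  apply: (subvP (addvSl _ _)); apply: mem_lie_span => //.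
  move: yB; apply: subvP; apply/lie_span_sub => u v uV vB; exact: (lie_idealP HB).
exact: addvSl.
Qed.

Lemma acts_nilpotently_ad N x : acts_nilpotently N -> x \in N -> lfun_nilpotent (ad x).
Proof.
move=> [k Hk] xN; exists k; apply/lfunP => v; rewrite zero_lfunE; apply/eqP.
rewrite -memv0 -Hk lfun_powE; elim: (k) => [|j IH] /=; first by rewrite memvf.
by rewrite adE mem_lie_span.
Qed.

(* Cartan's criterion: with rho the real part of ad [u, v], invariance of the
   trace moves rho onto K, so that tr (ad x \o rho) = 0. *)
Theorem cartan_criterion (K : {vspace g}) : lie_ideal fullv K ->
  {in K &, forall x y, ltr (ad x \o ad y)%VF = 0} -> lie_solvable K.
Proof.
move=> HK tr0; pose K' := lie_span K K.
have HK' : lie_ideal fullv K' by apply: lie_ideal_span.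
have K'K : (K' <= K)%VS.
  by apply/lie_span_sub => x y _; apply: (lie_idealP HK); rewrite memvf.
have nilK' : acts_nilpotently K'.
  apply: engel => [x y _|x xK']; first by apply: (lie_idealP HK'); rewrite memvf.
  have [q Hq] := real_part_exists (ad x).
  have xK := subvP K'K _ xK'.
  apply: (real_part_nilpotent Hq); last exact: tr0.
  have /derivation_adP dq := real_part_derivation Hq (derivation_ad x).
  move: dq; set rho := lpoly q (ad x) => dq.
  have rhoK v : v \in K -> rho v \in K.
    by apply: lpoly_stable => u uK; rewrite adE (lie_idealP HK) ?memvf.
  have [s [Hs ->]] := lie_span_sumP xK'.
  rewrite linear_sum big_seq; elim/big_rec: _ => [|p e /Hs[pK1 pK2] IH].
    by rewrite comp_lfun0l linear0.
  rewrite comp_lfunDl linearD /= IH addr0 ad_lie.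
  have -> : (((ad p.1 \o ad p.2) - (ad p.2 \o ad p.1)) \o rho)%VF =
     (ad p.1 \o (ad p.2 \o rho))%VF - (ad p.2 \o (ad p.1 \o rho))%VF.
    by apply/lfunP => v; rewrite !(comp_lfunE, add_lfunE, opp_lfunE).
  rewrite linearB /= [X in _ - X]ltr_comp -linearB /= -comp_lfunA.
  apply/eqP; rewrite -oppr_eq0 -linearN /=; apply/eqP.
  rewrite -[RHS](tr0 _ _ pK1 (rhoK _ pK2)) dq; congr ltr; apply/lfunP => v.
  by rewrite !(comp_lfunE, add_lfunE, opp_lfunE) [RHS]linearB opprB.
have [k Hk] := nilK'; exists k.+1.
rewrite /derived_series iterSr -/K' -/(derived_series _ _); apply/eqP; rewrite -subv0 -Hk.
have DK' j : (derived_series K' j <= K')%VS.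
  elim: j => //= j IH; apply: (subv_trans (lie_spanS IH IH)); apply/lie_span_sub => x y _.
  by apply: (lie_idealP HK'); rewrite memvf.
elim: (k) => [|j IH]; first by rewrite subvf.
by rewrite /= lie_spanS.
Qed.
End SolvableIdeal.

(** * The Killing form of a subalgebra *)

(** The proof of closure is an argument of the type, so that a Lie algebra structure can be attached
    to it. *)
Definition sub_lie (F : fieldType) (g : lieAlgType F) (U : {vspace g})
  (_ : lie_subalgebra U) := subvs_of U.

Section SubLie.
Variables (F : fieldType) (g : lieAlgType F) (U : {vspace g}).
Hypothesis subU : lie_subalgebra U.

HB.instance Definition _ := Vector.on (sub_lie subU).

Definition sub_bracket (x y : sub_lie subU) : sub_lie subU :=
  vsproj U (lie (vsval x) (vsval y)).

Lemma vsval_bracket x y : vsval (sub_bracket x y) = lie (vsval x) (vsval y).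
Proof. by rewrite vsprojK // subU ?subvsP. Qed.

Lemma sub_bracket_bilinear : bilinear_for *:%R *:%R sub_bracket.
Proof.
by split=> z a x y; apply: subvs_inj; rewrite linearP /= !vsval_bracket linearP /=
  ?(lieDl, lieDr, lieZl, lieZr).
Qed.

Lemma sub_bracketxx x : sub_bracket x x = 0.
Proof. by apply: subvs_inj; rewrite vsval_bracket liexx. Qed.

Lemma sub_bracket_jacobi x y z : sub_bracket x (sub_bracket y z) +
  sub_bracket y (sub_bracket z x) + sub_bracket z (sub_bracket x y) = 0.
Proof.
by apply: subvs_inj; rewrite !linearD /= !vsval_bracket lie_jacobi.
Qed.

HB.instance Definition _ := Vector_isLieAlgebra.Build F (sub_lie subU)
  sub_bracket_bilinear sub_bracketxx sub_bracket_jacobi.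

Local Notation h := (sub_lie subU : lieAlgType F).

Lemma vsval_lie (x y : h) : vsval (lie x y) = lie (vsval x) (vsval y).
Proof. exact: vsval_bracket. Qed.
End SubLie.

Lemma ltr_basis (F : fieldType) (V : vectType F) (f : 'End(V)) n (e : n.-tuple V) :
  basis_of {:V} e -> ltr f = \sum_(i < n) coord e i (f e`_i).
Proof.
move=> eb; rewrite ltrE; set b := vbasis _.
have bb : basis_of {:V} b := vbasisP _.
have -> : \sum_i coord b i (f b`_i) =
    \sum_(i < \dim {:V}) \sum_(j < n) coord e j b`_i * coord b i (f e`_j).
  apply: eq_bigr => i _; rewrite [b`_i in LHS](coord_basis eb (memvf _)) !linear_sum.
  by apply: eq_bigr => j _; rewrite /= !linearZ.
rewrite exchange_big; apply: eq_bigr => j _ /=.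
rewrite [in RHS](coord_basis bb (memvf (f e`_j))) linear_sum.
by apply: eq_bigr => i _; rewrite linearZ /= mulrC.
Qed.

Section Killing.
Variables (F : fieldType) (g : lieAlgType F) (U : {vspace g}).
Hypothesis subU : lie_subalgebra U.
Local Notation h := (sub_lie subU : lieAlgType F).

Lemma killing_ltr (x y : h) : killing U (vsval x) (vsval y) = ltr (ad x \o ad y)%VF.
Proof.
pose e : (\dim U).-tuple h := [tuple of map (vsproj U) (vbasis U)].
have ee (i : 'I_(\dim U)) : vsval (e`_i : h) = (vbasis U)`_i.
  by rewrite (nth_map 0) ?size_tuple // vsprojK // vbasis_mem // mem_nth ?size_tuple.
have sum_e (w : h) : w = \sum_i coord (vbasis U) i (vsval w) *: e`_i.
  apply: subvs_inj; rewrite linear_sum [LHS](coord_vbasis (subvsP w)).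
  by apply: eq_bigr => i _; rewrite linearZ /= ee.
have spe : <<e>>%VS = {:h}%VS.
  apply/eqP; rewrite eqEsubv subvf; apply/subvP => w _.
  by rewrite [w]sum_e memv_suml // => i _; rewrite memvZ // memv_span // mem_nth ?size_tuple.
have dimh : \dim {:h} = \dim U by rewrite dimvf.
have eb : basis_of {:h} e.
  by rewrite basisEdim spe subvv size_tuple dimh leqnn.
rewrite (ltr_basis _ eb); apply: eq_bigr => i _.
rewrite comp_lfunE !adE -ee -!vsval_lie.
by rewrite [in RHS](sum_e (lie x (lie y e`_i))) coord_sum_free // (basis_free eb).
Qed.

Lemma killing_ad x y : x \in U -> y \in U ->
  killing U x y = ltr (ad (vsproj U x : h) \o ad (vsproj U y : h))%VF.
Proof. by move=> xU yU; rewrite -killing_ltr !vsprojK. Qed.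

Lemma killingC x y : x \in U -> y \in U -> killing U x y = killing U y x.
Proof. by move=> xU yU; rewrite !killing_ad // ltr_comp. Qed.

Lemma killingDl x y z : killing U (x + y) z = killing U x z + killing U y z.
Proof. by rewrite -big_split; apply: eq_bigr => i _; rewrite lieDl linearD. Qed.
Lemma killingZl a x z : killing U (a *: x) z = a * killing U x z.
Proof. by rewrite mulr_sumr; apply: eq_bigr => i _; rewrite lieZl linearZ. Qed.
Lemma killingDr x y z : killing U z (x + y) = killing U z x + killing U z y.
Proof. by rewrite -big_split; apply: eq_bigr => i _; rewrite lieDl lieDr linearD. Qed.
Lemma killingZr a x z : killing U z (a *: x) = a * killing U z x.
Proof. by rewrite mulr_sumr; apply: eq_bigr => i _; rewrite lieZl lieZr linearZ. Qed.

Lemma killing_lie x y z : x \in U -> y \in U -> z \in U ->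
  killing U (lie x y) z = killing U x (lie y z).
Proof.
move=> xU yU zU; rewrite !killing_ad ?subU //.
have E u v : u \in U -> v \in U ->
    (vsproj U (lie u v) : h) = lie (vsproj U u : h) (vsproj U v : h).
  by move=> uU vU; apply: subvs_inj; rewrite vsval_lie !vsprojK ?subU.
rewrite !E //; move: (vsproj U x : h) (vsproj U y : h) (vsproj U z : h) => X Y Z.
have -> : (ad (lie X Y) \o ad Z)%VF
   = (ad X \o (ad Y \o ad Z))%VF - (ad Y \o (ad X \o ad Z))%VF.
  by apply/lfunP => v; rewrite ad_lie !(comp_lfunE, add_lfunE, opp_lfunE).
rewrite linearB /= [X in _ - X]ltr_comp -linearB /=; congr ltr; apply/lfunP => v.
by rewrite ad_lie !(comp_lfunE, add_lfunE, opp_lfunE) [RHS]linearB.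
Qed.

(** Encoded as the kernel of a map into rows of length [\dim J], so that rank-nullity bounds its
    dimension from below. *)
Definition killing_orth (J : {vspace g}) : {vspace g} :=
  (U :&: lker (linfun (fun x => \row_(i < \dim J) killing U x (vbasis J)`_i)%R))%VS.

Lemma killing_row_linear (J : {vspace g}) :
  linear (fun x => \row_(i < \dim J) killing U x (vbasis J)`_i).
Proof. by move=> a x y; apply/rowP => i; rewrite !mxE killingDl killingZl. Qed.

Lemma mem_killing_orth J x :
  x \in killing_orth J <-> x \in U /\ {in J, forall y, killing U x y = 0}.
Proof.
rewrite /killing_orth; set phi := (fun x => _).
pose lphi := HB.pack_for {linear g -> 'rV[F]_(\dim J)} phi
  (GRing.isLinear.Build F g 'rV[F]_(\dim J) _ phi (killing_row_linear J)).
have phiE z : linfun phi z = phi z by exact: (lfunE lphi).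
rewrite memv_cap memv_ker phiE; split=> [/andP[xU /eqP H]|[xU H]]; last first.
  rewrite xU; apply/eqP/rowP => i; rewrite !mxE H // vbasis_mem // mem_nth //.
  by rewrite size_tuple.
split=> // y /coord_vbasis ->.
have suml (a : 'I_(\dim J) -> F) (X : 'I_(\dim J) -> g) :
    killing U x (\sum_i a i *: X i) = \sum_i a i * killing U x (X i).
  elim/big_rec2: _ => [|i u v _ <-]; last by rewrite killingDr killingZr.
  by rewrite -(scale0r 0) killingZr mul0r.
rewrite suml big1 // => i _; have /rowP/(_ i) := H; rewrite !mxE => ->.
by rewrite mulr0.
Qed.

Lemma dim_killing_orth J : (\dim U <= \dim (killing_orth J) + \dim J)%N.
Proof.
rewrite /killing_orth; set f := linfun _.
rewrite -(limg_ker_dim f U) leq_add2l; apply: leq_trans (dimvS (subvf _)) _.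
by rewrite dimvf dim_matrix mul1r.
Qed.

Lemma killing_orth_ideal J : lie_ideal U J -> lie_ideal U (killing_orth J).
Proof.
move=> HJ; split; first exact: capvSl.
move=> x y xU /mem_killing_orth[yU H]; apply/mem_killing_orth; split; first exact: subU.
move=> z zJ; have zU := subvP HJ.1 _ zJ.
rewrite lieC -scaleN1r killingZl killing_lie // H ?mulr0 //.
exact: (lie_idealP HJ).
Qed.
End Killing.

(** * Consequences of Cartan's criterion for semisimple subalgebras *)

Section Semisimple.
Variables (R : realType) (g : lieAlgType R).
Implicit Types (U J K : {vspace g}).

(** Cartan's criterion, applied inside U as a Lie algebra of its own, makes K solvable; the derived
    series is carried back along the inclusion. *)
Lemma killing_semisimple U K : lie_semisimple U -> lie_ideal U K ->
  {in K &, forall x y, killing U x y = 0} -> K = 0%VS.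
Proof.
case=> subU ssU HK K0; apply: (ssU K HK).
pose h : lieAlgType R := sub_lie subU; pose v : 'Hom(h, g) := linfun (@vsval _ _ U).
have vE x : v x = vsval x by rewrite lfunE.
pose K' := (v @^-1: K)%VS.
have mK' x : (x \in K') = (vsval x \in K) by rewrite -memv_preim vE.
have [n Hn] : lie_solvable K'.
  apply: cartan_criterion => [|x y]; last by rewrite !mK' => xK yK; rewrite -killing_ltr K0.
  split; first exact: subvf.
  by move=> x y _; rewrite !mK' vsval_lie; apply: (lie_idealP HK); apply: subvsP.
exists n; apply/eqP; rewrite -subv0.
suff H j : (derived_series K j <= v @: derived_series K' j)%VS by rewrite -(limg0 v) -Hn.
elim: j => [|j IH] /=.
  apply/subvP => x xK; have xU := subvP HK.1 _ xK.
  by apply/memv_imgP; exists (vsproj U x); rewrite ?mK' ?vE vsprojK.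
apply: (subv_trans (lie_spanS IH IH)); apply/lie_span_sub => _ _ /memv_imgP[a aK ->] /memv_imgP[b bK ->].
by rewrite !vE -(vsval_lie (subU := subU)) -vE memv_img // mem_lie_span.
Qed.

(** The Killing orthogonal works: it meets J in an isotropic ideal, hence in 0, and its dimension
    suffices. An ideal of it is an ideal of U, since J commutes with it. *)
Lemma semisimple_ideal_complement U J : lie_semisimple U -> lie_ideal U J ->
  exists J', [/\ lie_ideal U J', (J + J')%VS = U, (J :&: J')%VS = 0%VS &
    lie_semisimple J'].
Proof.
move=> ssU HJ; have subU := ssU.1; pose J' := killing_orth U J.
have HJ' : lie_ideal U J' by apply: killing_orth_ideal.
have JJ'0 : (J :&: J')%VS = 0%VS.
  apply: (killing_semisimple ssU).
    split; first exact: subv_trans (capvSl _ _) HJ.1.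
    move=> x y xU /memv_capP[yJ yJ']; apply/memv_capP.
    by split; [apply: (lie_idealP HJ) | apply: (lie_idealP HJ')].
  move=> x y /memv_capP[_ /mem_killing_orth[_ H]] /memv_capP[yJ _].
  exact: H.
have sumJ : (J + J')%VS = U.
  apply/eqP; rewrite eqEdim subv_add HJ.1 HJ'.1 /= dimv_disjoint_sum // addnC.
  exact: dim_killing_orth.
exists J'; split => //; split.
  by move=> x y xJ yJ; apply: (lie_idealP HJ') => //; apply: (subvP HJ'.1).
move=> I HI solI; apply: ssU.2 => //; split; first exact: subv_trans HI.1 HJ'.1.
move=> x y; rewrite -sumJ => /memv_addP[a aJ [b bJ' ->]] yI.
have yJ' := subvP HI.1 _ yI.
rewrite lieDl (_ : lie a y = 0) ?add0r; first exact: (lie_idealP HI).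
apply/eqP; rewrite -memv0 -JJ'0; apply/memv_capP; split.
  by apply: (lie_idealPr HJ) => //; apply: (subvP HJ'.1).
by apply: (lie_idealP HJ') => //; apply: (subvP HJ.1).
Qed.

Lemma killing_semidefinite_definite U : lie_semisimple U ->
  {in U, forall x, killing U x x <= 0} -> killing_definite U.
Proof.
move=> ssU neg; right=> x xU; apply: contraNT; rewrite -leNgt => ge0.
have subU := ssU.1.
have xx0 : killing U x x = 0 by apply/eqP; rewrite eq_le neg.
have K0 : killing_orth U U = 0%VS.
  apply: (killing_semisimple ssU); first exact/(killing_orth_ideal subU)/lie_ideal_full.
  move=> y z /mem_killing_orth[_ H] /mem_killing_orth[zU _]; exact: H.
rewrite -memv0 -K0; apply/mem_killing_orth; split => // y yU.
apply/eqP/negPn/negP => xy0.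
(* With x isotropic, the Killing form at y + t x is affine in t; this t gives it the value 1. *)
pose t := (1 - killing U y y) / (2 * killing U x y).
have := neg (y + t *: x); rewrite memvD ?memvZ // => /(_ isT).
rewrite !killingDl !killingDr !killingZl !killingZr xx0 (killingC subU yU xU) !mulr0 addr0.
have -> : killing U y y + t * killing U x y + t * killing U x y = 1.
  by rewrite /t; field.
by rewrite ler10.
Qed.
End Semisimple.

(** * Exponential polynomials *)

Section ExpPoly.
Variable F : numFieldType.

Lemma poly_nat_roots (p : {poly F}) : (forall n : nat, p.[n%:R] = 0) -> p = 0.
Proof.
move=> H; apply: (@roots_geq_poly_eq0 _ p [seq n%:R | n <- iota 0 (size p)]).
- by apply/allP => _ /mapP[n _ ->]; rewrite /root H.
- by rewrite map_inj_uniq ?iota_uniq // => m n /eqP; rewrite eqr_nat => /eqP.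
by rewrite size_map size_iota.
Qed.

Let shift (p : {poly F}) := p \Po ('X + 1%:P).

Lemma size_shift p : size (shift p) = size p.
Proof. by rewrite size_comp_poly2 // size_XaddC. Qed.

Lemma lead_coef_shift p : lead_coef (shift p) = lead_coef p.
Proof. by rewrite lead_coef_comp ?size_XaddC // lead_coefXaddC expr1n mulr1. Qed.

Lemma size_shift_sub p : p != 0 -> (size (shift p - p)%R < size p)%N.
Proof.
move=> p0; rewrite -[X in (_ < X)%N]prednK ?size_poly_gt0 // ltnS; apply/leq_sizeP => j.
rewrite leq_eqVlt => /orP[/eqP <-|lt].
  by rewrite coefB -{1}(size_shift p) -!lead_coefE lead_coef_shift subrr.
rewrite -[(size p).-1.+1]/(_) prednK ?size_poly_gt0 // in lt.
by rewrite coefB !nth_default ?subrr // size_shift.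
Qed.

(** The operator shift minus b lowers the degree of the polynomial at b and raises no other, which
    allows induction on the total size. It leaves a q_a(X + 1) = b q_a(X); leading coefficients
    force q_a = 0 for a != b, and the remaining term vanishes at every integer. *)
Lemma exp_poly_indep (s : seq F) (q : F -> {poly F}) : uniq s -> 0 \notin s ->
  (forall n : nat, \sum_(a <- s) a ^+ n * (q a).[n%:R] = 0) ->
  forall a, a \in s -> q a = 0.
Proof.
move=> us s0; have [m Hm] := ubnP (\sum_(a <- s) size (q a))%N.
elim: m q Hm => // m IH q Hm Hq.
have [/hasP[b bs qb]|/hasPn H] := boolP (has (fun a => q a != 0) s); last first.
  by move=> a /H; rewrite negbK => /eqP.
exfalso; have b0 : b != 0 by apply: contraNneq s0 => <-.
pose q' a := a *: shift (q a) - b *: q a.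
have sz a : (size (q' a) <= size (q a))%N.
  apply: leq_trans (size_polyD _ _) _; rewrite size_polyN geq_max.
  by rewrite -{1}(size_shift (q a)) !size_scale_leq.
have q'0 a : a \in s -> q' a = 0.
  apply: IH => [|n].
    rewrite -ltnS; apply: leq_trans Hm; rewrite ltnS (big_rem b) //= [X in (_ < X)%N](big_rem b) //=.
    rewrite -addSn leq_add //; last by apply: leq_sum.
    by rewrite /q' -scalerBr size_scale // size_shift_sub.
  transitivity (\sum_(a <- s) a ^+ n.+1 * (q a).[n.+1%:R] -
      b * \sum_(a <- s) a ^+ n * (q a).[n%:R]); last by rewrite !Hq mulr0 subr0.
  rewrite mulr_sumr -sumrB; apply: eq_bigr => a' _.
  rewrite /q' /shift hornerD hornerN !hornerZ horner_comp hornerD hornerX hornerC -natr1 exprS.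
  by rewrite mulrBr !mulrA [a' * _]mulrC [b * _]mulrC.
have q0 a : a \in s -> a != b -> q a = 0.
  move=> /q'0 /eqP; rewrite subr_eq0 => /eqP /(congr1 lead_coef).
  rewrite !lead_coefZ lead_coef_shift => /eqP; rewrite -subr_eq0 -mulrBl mulf_eq0 subr_eq0.
  by case/orP => [->|] //; rewrite lead_coef_eq0 => /eqP.
case/eqP: qb; apply: poly_nat_roots => n.
have := Hq n; rewrite (bigD1_seq b) //= big_seq_cond big1 => [|a /andP[as' ab]].
  by rewrite addr0 => /eqP; rewrite mulf_eq0 expf_eq0 (negbTE b0) andbF => /eqP.
by rewrite q0 // horner0 mulr0.
Qed.

(** Terms with equal base are collected first; each collected polynomial is then zero and can be
    evaluated at any u, independently of n. *)
Lemma exp_poly_vanish (s : seq (F * {poly F})) : all (fun t => t.1 != 0) s ->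
  (forall n : nat, \sum_(t <- s) t.1 ^+ n * t.2.[n%:R] = 0) ->
  forall n u, \sum_(t <- s) t.1 ^+ n * t.2.[u] = 0.
Proof.
move=> s0 H; pose U := undup [seq t.1 | t <- s].
pose q a := \sum_(t <- s | t.1 == a) t.2.
have E n u : \sum_(t <- s) t.1 ^+ n * t.2.[u] = \sum_(a <- U) a ^+ n * (q a).[u].
  under [RHS]eq_bigr do rewrite horner_sum mulr_sumr.
  rewrite (exchange_big_dep predT) //= big_seq [RHS]big_seq; apply: eq_bigr => t ts.
  have tU : t.1 \in U by rewrite mem_undup map_f.
  rewrite -big_filter (_ : seq.filter _ _ = [:: t.1]) ?big_seq1 //.
  by have := filter_pred1_uniq (undup_uniq _) tU; under eq_filter do rewrite /= eq_sym.
move=> n u; rewrite E big_seq big1 // => a aU; rewrite (@exp_poly_indep U q) ?horner0 ?mulr0 ?undup_uniq //.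
  rewrite mem_undup; apply/negP => /mapP[t ts t0].
  by have := allP s0 t ts; rewrite -t0 eqxx.
by move=> k; rewrite -E.
Qed.

End ExpPoly.

Section ExpPolyFun.
Local Open Scope complex_scope.
Variable R : rcfType.
Local Notation C := R[i].

(** The exponent n and the polynomial variable u are kept apart, so that an identity known for u = n
    extends to independent values. *)
Definition exp_poly (f : nat -> R -> C) := exists s : seq (C * {poly C}),
  all (fun t => t.1 != 0) s /\ forall n u, f n u = \sum_(t <- s) t.1 ^+ n * t.2.[u%:C].

Lemma exp_poly_ext f h : (forall n u, f n u = h n u) -> exp_poly f -> exp_poly h.
Proof. by move=> E [s [s0 H]]; exists s; split => // n u; rewrite -E. Qed.

Lemma exp_poly_poly (p : {poly C}) : exp_poly (fun _ u => p.[u%:C]).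
Proof.
exists [:: (1, p)]; rewrite /= oner_neq0; split => // n u.
by rewrite big_seq1 expr1n mul1r.
Qed.

Lemma exp_poly_cst c : exp_poly (fun _ _ => c).
Proof. by apply: exp_poly_ext (exp_poly_poly c%:P) => n u; rewrite hornerC. Qed.

Lemma exp_poly_exp a : a != 0 -> exp_poly (fun n _ => a ^+ n).
Proof.
move=> a0; exists [:: (a, 1)]; rewrite /= a0; split => // n u.
by rewrite big_seq1 hornerC mulr1.
Qed.

Lemma exp_polyD f h : exp_poly f -> exp_poly h -> exp_poly (fun n u => f n u + h n u).
Proof.
move=> [s [s0 Hs]] [t [t0 Ht]]; exists (s ++ t); rewrite all_cat s0 t0; split => // n u.
by rewrite big_cat Hs Ht.
Qed.

Lemma exp_polyM f h : exp_poly f -> exp_poly h -> exp_poly (fun n u => f n u * h n u).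
Proof.
move=> [s [s0 Hs]] [t [t0 Ht]].
exists [seq (x.1 * y.1, x.2 * y.2) | x <- s, y <- t]; split => [|n u].
  apply/allP => _ /allpairsP[[x y] /= [xs yt ->]] /=.
  by apply: mulf_neq0; [exact: (allP s0) | exact: (allP t0)].
rewrite Hs Ht big_allpairs_dep mulr_suml; apply: eq_bigr => x _; rewrite mulr_sumr.
by apply: eq_bigr => y _ /=; rewrite exprMn hornerM; ring.
Qed.

Lemma exp_poly_sum (I : Type) (r : seq I) (P : pred I) (f : I -> nat -> R -> C) :
  (forall i, P i -> exp_poly (f i)) -> exp_poly (fun n u => \sum_(i <- r | P i) f i n u).
Proof.
move=> H; elim: r => [|i r IH].
  by apply: exp_poly_ext (exp_poly_cst 0) => n u; rewrite big_nil.
have [Pi|nPi] := boolP (P i); last first.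
  by apply: exp_poly_ext IH => n u; rewrite big_cons (negbTE nPi).
by apply: exp_poly_ext (exp_polyD (H i Pi) IH) => n u; rewrite big_cons Pi.
Qed.

Lemma exp_poly_prod (I : Type) (r : seq I) (P : pred I) (f : I -> nat -> R -> C) :
  (forall i, P i -> exp_poly (f i)) -> exp_poly (fun n u => \prod_(i <- r | P i) f i n u).
Proof.
move=> H; elim: r => [|i r IH].
  by apply: exp_poly_ext (exp_poly_cst 1) => n u; rewrite big_nil.
have [Pi|nPi] := boolP (P i); last first.
  by apply: exp_poly_ext IH => n u; rewrite big_cons (negbTE nPi).
by apply: exp_poly_ext (exp_polyM (H i Pi) IH) => n u; rewrite big_cons Pi.
Qed.

Lemma exp_polyX f k : exp_poly f -> exp_poly (fun n u => f n u ^+ k).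
Proof.
move=> H; elim: k => [|k IH]; first exact: exp_poly_cst.
by apply: exp_poly_ext (exp_polyM H IH) => n u; rewrite exprS.
Qed.

Lemma exp_poly_diag0 f : exp_poly f -> (forall n : nat, f n n%:R = 0) ->
  forall n u, f n u = 0.
Proof.
move=> [s [s0 Hs]] H n u; rewrite Hs; apply: exp_poly_vanish => // k.
by rewrite -[RHS](H k) Hs; apply: eq_bigr => t _; rewrite rmorph_nat.
Qed.
End ExpPolyFun.

(** * The exponential and the algebraic hull of Inn(g) *)

Lemma sum_triangle (V : zmodType) (f : nat -> nat -> V) m :
  \sum_(n < m) \sum_(j < n.+1) f j (n - j)%N = \sum_(j < m) \sum_(k < m - j) f j k.
Proof.
elim: m => [|m IH]; first by rewrite !big_ord0.
rewrite big_ord_recr /= IH.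
have -> : \sum_(j < m) \sum_(k < m - j) f j k = \sum_(j < m.+1) \sum_(k < m - j) f j k.
  by rewrite [RHS]big_ord_recr /= subnn big_ord0 addr0.
by rewrite -big_split; apply: eq_bigr => j _ /=; rewrite subSn -1?ltnS // big_ord_recr.
Qed.

Section TExp.
Variables (F : numFieldType) (n : nat).
Implicit Types A B : 'M[F]_n.

Definition texp m A : 'M[F]_n := \sum_(k < m) (k`!%:R^-1) *: A ^+ k.

(** Truncation by total degree pairs the term of degree j in A with the exponential of B cut off at
    m - j. *)
Lemma texpD m A B : A *m B = B *m A ->
  texp m (A + B) = \sum_(j < m) texp (m - j) B *m (j`!%:R^-1 *: A ^+ j).
Proof.
move=> AB; pose f j k : 'M[F]_n := (k`!%:R^-1 *: B ^+ k) *m (j`!%:R^-1 *: A ^+ j).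
transitivity (\sum_(n < m) \sum_(j < n.+1) f j (n - j)%N).
  apply: eq_bigr => k _; rewrite addrC exprDn_comm; last exact: esym.
  rewrite scaler_sumr; apply: eq_bigr => j _.
  have jk : (j <= k)%N by rewrite -ltnS.
  rewrite /f -scalemxAl -scalemxAr scalerA -[_ *+ 'C(_, _)]scaler_nat scalerA; congr (_ *: _).
  have c0 : 'C(k, j)%:R != 0 :> F by rewrite pnatr_eq0 -lt0n bin_gt0.
  rewrite -(bin_fact jk) !natrM; move: c0; move: ('C(k, j)%:R : F) => c c0.
  by rewrite invfM mulrAC mulVf // mul1r invfM mulrC.
by rewrite sum_triangle; apply: eq_bigr => j _; rewrite mulmx_suml.
Qed.

Lemma texp_nilpotent m k A : A ^+ k = 0 -> (k <= m)%N -> texp m A = texp k A.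
Proof.
move=> Ak km; rewrite /texp -(subnKC km) big_split_ord /= [X in _ + X]big1 ?addr0 // => i _.
by rewrite exprD Ak mul0r scaler0.
Qed.

Lemma exprZmx a A k : (a *: A) ^+ k = a ^+ k *: A ^+ k.
Proof.
elim: k => [|k IH]; first by rewrite !expr0 scale1r.
by rewrite !exprS IH -[_ * _]/(_ *m _) -scalemxAl -scalemxAr scalerA.
Qed.

Lemma texpD_nilpotent m k A B : A *m B = B *m A -> A ^+ k = 0 -> (k <= m)%N ->
  texp m (A + B) = \sum_(j < k) texp (m - j) B *m (j`!%:R^-1 *: A ^+ j).
Proof.
move=> AB Ak km; rewrite texpD // -(subnKC km) big_split_ord /= [X in _ + X]big1 ?addr0 // => i _.
by rewrite exprD Ak mul0r scaler0 mulmx0.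
Qed.

Lemma texpD_nil k A (u v : F) : A ^+ k = 0 ->
  texp k ((u + v) *: A) = texp k (v *: A) *m texp k (u *: A).
Proof.
move=> Ak; have zk w : (w *: A) ^+ k = 0 by rewrite exprZmx Ak scaler0.
rewrite -(texp_nilpotent (zk _) (leq_addr k k)) scalerDl (@texpD_nilpotent _ k) ?leq_addr //.
  rewrite mulmx_sumr; apply: eq_bigr => j _; congr (_ *m _).
  by apply: texp_nilpotent => //; rewrite -addnBA ?leq_addr // ltnW.
by rewrite -!scalemxAl -!scalemxAr !scalerA mulrC.
Qed.

Lemma texp0 k : texp k.+1 0 = 1%:M.
Proof.
rewrite /texp big_ord_recl expr0 fact0 invr1 scale1r big1 ?addr0 // => i _.
by rewrite expr0n scaler0.
Qed.
End TExp.

(** * Convergence of the matrix exponential *)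

Section Cvg.
Local Open Scope classical_set_scope.
Variable R : realType.

Lemma cvgn_sum (I : Type) (r : seq I) (f : I -> nat -> R) (l : I -> R) :
  (forall i, f i @ \oo --> l i) ->
  (fun n => \sum_(i <- r) f i n) @ \oo --> \sum_(i <- r) l i.
Proof.
move=> H; elim: r => [|i r IH].
  by rewrite big_nil (_ : (fun _ => _) = fun=> 0); [exact: cvg_cst | apply/funext => n; rewrite big_nil].
rewrite big_cons (_ : (fun _ => _) = f i \+ (fun n => \sum_(j <- r) f j n)); first exact: cvgD.
by apply/funext => n; rewrite big_cons.
Qed.

Lemma cvg_mx_linear m n (T : nat -> 'M[R]_(m, n)) (E : 'M[R]_(m, n)) (psi : 'M[R]_(m, n) -> R) :
  (forall a A B, psi (a *: A + B) = a * psi A + psi B) ->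
  (forall i j, (fun k => T k i j) @ \oo --> E i j) ->
  (fun k => psi (T k)) @ \oo --> psi E.
Proof.
move=> lin cT.
have psi0 : psi 0 = 0.
  by have := lin (-1) 0 0; rewrite scaler0 addr0 mulN1r addNr.
have psiE A : psi A = \sum_i \sum_j A i j * psi (delta_mx i j).
  have sum (I : finType) (a : I -> R) (X : I -> 'M[R]_(m, n)) :
      psi (\sum_i a i *: X i) = \sum_i a i * psi (X i).
    by elim/big_rec2: _ => [|i x y _ <-]; rewrite ?lin.
  rewrite [in LHS](matrix_sum_delta A).
  have -> : \sum_i \sum_j A i j *: delta_mx i j = \sum_i 1 *: (\sum_j A i j *: delta_mx i j).
    by apply: eq_bigr => i _; rewrite scale1r.
  by rewrite sum; apply: eq_bigr => i _; rewrite mul1r sum.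
rewrite psiE (_ : (fun k => psi (T k)) = fun k => \sum_i \sum_j T k i j * psi (delta_mx i j)); last first.
  by apply/funext => k; rewrite psiE.
apply: cvgn_sum => i; apply: cvgn_sum => j; apply: cvgM; first exact: cT.
exact: cvg_cst.
Qed.

Lemma cvg_mx_linear0 m n (T : nat -> 'M[R]_(m, n)) (E : 'M[R]_(m, n)) (psi : 'M[R]_(m, n) -> R) :
  (forall a A B, psi (a *: A + B) = a * psi A + psi B) ->
  (forall i j, (fun k => T k i j) @ \oo --> E i j) ->
  (forall k, psi (T k) = 0) -> psi E = 0.
Proof.
move=> lin cT T0; apply: (@norm_cvg_unique _ _ ((fun k => psi (T k)) @ \oo)).
  exact: cvg_mx_linear.
by rewrite (_ : (fun k => _) = fun=> 0); [exact: cvg_cst | apply/funext].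
Qed.

Definition mnorm m n (A : 'M[R]_(m, n)) := \sum_i \sum_j `|A i j|.

Lemma mnorm_ge0 m n (A : 'M[R]_(m, n)) : 0 <= mnorm A.
Proof. by apply: sumr_ge0 => i _; apply: sumr_ge0. Qed.

Lemma le_mnorm m n (A : 'M[R]_(m, n)) i j : `|A i j| <= mnorm A.
Proof.
rewrite /mnorm (bigD1 i) //= (bigD1 j) //= -addrA lerDl addr_ge0 ?sumr_ge0 // => k _.
by rewrite sumr_ge0.
Qed.

Lemma mnormM m n p (A : 'M[R]_(m, n)) (B : 'M[R]_(n, p)) :
  mnorm (A *m B) <= mnorm A * mnorm B.
Proof.
rewrite /mnorm mulr_suml; apply: ler_sum => i _.
apply: le_trans (_ : \sum_k \sum_j `|A i j| * `|B j k| <= _).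
  apply: ler_sum => k _; rewrite mxE; apply: le_trans (ler_norm_sum _ _ _) _.
  by apply: ler_sum => j _; rewrite normrM.
rewrite exchange_big mulr_suml /=; apply: ler_sum => j _; rewrite -mulr_sumr.
apply: ler_wpM2l => //; rewrite [X in _ <= X](bigD1 j) //= lerDl sumr_ge0 // => k _.
by rewrite sumr_ge0.
Qed.

Lemma mnormZ m n a (A : 'M[R]_(m, n)) : mnorm (a *: A) = `|a| * mnorm A.
Proof.
rewrite /mnorm mulr_sumr; apply: eq_bigr => i _; rewrite mulr_sumr.
by apply: eq_bigr => j _; rewrite mxE normrM.
Qed.

Lemma mnormD m n (A B : 'M[R]_(m, n)) : mnorm (A + B) <= mnorm A + mnorm B.
Proof.
rewrite /mnorm -big_split; apply: ler_sum => i _; rewrite -big_split.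
by apply: ler_sum => j _; rewrite mxE ler_normD.
Qed.

Lemma mnorm_sum m n (I : Type) (r : seq I) (f : I -> 'M[R]_(m, n)) :
  mnorm (\sum_(i <- r) f i) <= \sum_(i <- r) mnorm (f i).
Proof.
elim: r => [|i r IH]; last by rewrite !big_cons (le_trans (mnormD _ _)) // lerD2l.
by rewrite !big_nil /mnorm big1 // => i _; rewrite big1 // => j _; rewrite mxE normr0.
Qed.

Lemma mnorm_eq0 m n (A : 'M[R]_(m, n)) : mnorm A <= 0 -> A = 0.
Proof.
by move=> A0; apply/matrixP => i j; rewrite mxE; apply/eqP; rewrite -normr_le0 (le_trans (le_mnorm _ _ _)).
Qed.

Section SmallExp.
Variables (n : nat) (X : 'M[R]_n).
Hypothesis X_small : mnorm X <= 4^-1.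

Lemma mnorm_small_pow m (A : 'M[R]_(m, n)) k : mnorm (A *m X ^+ k) <= mnorm A * 4^-1 ^+ k.
Proof.
elim: k => [|k IH]; first by rewrite !expr0 mulmx1 mulr1.
rewrite exprSr -[_ * X]/(_ *m _) mulmxA exprSr mulrA (le_trans (mnormM _ _)) //.
by apply: ler_pM => //; apply: mnorm_ge0.
Qed.

Lemma texp_entry i j m : texp m X i j = series (fun k => (k`!%:R^-1 *: X ^+ k) i j) m.
Proof. by rewrite /series /= big_mkord /texp summxE. Qed.

Lemma invfact_le1 k : (k`!%:R^-1 : R) <= 1.
Proof. by rewrite invf_le1 ?ltr0n ?fact_gt0 // ler1n fact_gt0. Qed.

Lemma texp_small_cvg : exists E : 'M[R]_n,
  forall i j, (fun m => texp m X i j) @ \oo --> E i j.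
Proof.
exists (\matrix_(i, j) limn (series (fun k => (k`!%:R^-1 *: X ^+ k) i j))) => i j.
rewrite mxE (_ : (fun m => _) = series (fun k => (k`!%:R^-1 *: X ^+ k) i j)); last first.
  by apply/funext => m; rewrite texp_entry.
apply: normed_cvg.
apply: (@series_le_cvg _ _ (geometric (mnorm (1%:M : 'M[R]_n)) 4^-1)) => [k|k|k|].
- exact: normr_ge0.
- by rewrite /= mulr_ge0 ?mnorm_ge0 // exprn_ge0.
- rewrite /= mxE normrM ger0_norm ?invr_ge0 ?ler0n //.
  apply: le_trans (_ : 1 * mnorm (X ^+ k) <= _).
    by apply: ler_pM; rewrite ?invr_ge0 ?ler0n ?invfact_le1 ?le_mnorm.
  by rewrite mul1r -[X ^+ k]mul1mx; apply: mnorm_small_pow.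
by apply: is_cvg_geometric_series; rewrite ger0_norm ?invr_ge0 //; lra.
Qed.

(** The bound 1/4 makes the terms after the first sum to at most 1/3 of the norm of v, so [v *m E]
    keeps at least 2/3 of it and E is injective; no inverse series is involved. *)
Lemma texp_small_unit (E : 'M[R]_n) : (forall i j, (fun m => texp m X i j) @ \oo --> E i j) ->
  E \in unitmx.
Proof.
move=> cE; rewrite -row_free_unit; apply: inj_row_free => v vE.
apply: mnorm_eq0.
have geo m : \sum_(k < m) (4^-1 : R) ^+ k.+1 <= 3^-1.
  suff -> : \sum_(k < m) (4^-1 : R) ^+ k.+1 = 3^-1 * (1 - 4^-1 ^+ m).
    by rewrite ler_piMr ?invr_ge0 // lerBlDr lerDl exprn_ge0 // invr_ge0.
  elim: m => [|m IH]; first by rewrite big_ord0 expr0 subrr mulr0.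
  by rewrite big_ord_recr /= IH exprS; field.
have bound m : mnorm v * (2 / 3) <= mnorm (v *m texp m.+1 X).
  have E1 : v *m texp m.+1 X = v + \sum_(k < m) (k.+1`!%:R^-1) *: (v *m X ^+ k.+1).
    rewrite /texp big_ord_recl expr0 fact0 invr1 scale1r mulmxDr mulmx1; congr (_ + _).
    by rewrite mulmx_sumr; apply: eq_bigr => k _; rewrite -scalemxAr.
  have E2 : mnorm (\sum_(k < m) (k.+1`!%:R^-1) *: (v *m X ^+ k.+1)) <= mnorm v * 3^-1.
    apply: le_trans (mnorm_sum _ _) _.
    apply: le_trans (_ : \sum_(k < m) mnorm v * 4^-1 ^+ k.+1 <= _).
      apply: ler_sum => k _; rewrite mnormZ ger0_norm ?invr_ge0 ?ler0n //.
      rewrite -[X in _ <= X]mul1r; apply: ler_pM; rewrite ?invr_ge0 ?ler0n ?mnorm_ge0 ?invfact_le1 //.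
      exact: mnorm_small_pow.
    by rewrite -mulr_sumr ler_wpM2l ?mnorm_ge0.
  have := mnormD (v *m texp m.+1 X) (- \sum_(k < m) (k.+1`!%:R^-1) *: (v *m X ^+ k.+1)).
  rewrite {1}E1 addrK -scaleN1r mnormZ normrN1 mul1r => H; lra.
have lim0 : (fun m => mnorm (v *m texp m X)) @ \oo --> (0 : R).
  have -> : (0 : R) = \sum_(i < 1) \sum_(j < n) 0 by rewrite big1 // => i _; rewrite big1.
  apply: (cvgn_sum (l := fun=> \sum_(j < n) 0)) => i; apply: (cvgn_sum (l := fun=> 0)) => j.
  have -> : (0 : R) = `| (v *m E) i j | by rewrite vE mxE normr0.
  apply: cvg_norm; apply: (cvg_mx_linear (T := fun m => texp m X) (psi := fun A => (v *m A) i j)) => //.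
  by move=> a A B; rewrite mulmxDr -scalemxAr !mxE.
have : mnorm v * (2 / 3) <= 0.
  apply: (cvgr_to_ge lim0); exists 1%N => // m /= m1.
  by have := bound m.-1; rewrite prednK.
by rewrite pmulr_lle0 //; lra.
Qed.
End SmallExp.
End Cvg.

Section ComplexParts.
Local Open Scope complex_scope.
Variable R : rcfType.

Lemma ReZD (a : R) (z w : R[i]) :
  complex.Re (a%:C * z + w) = a * complex.Re z + complex.Re w.
Proof. by case: z w => [z1 z2] [w1 w2] /=; rewrite mul0r subr0. Qed.

Lemma ImZD (a : R) (z w : R[i]) :
  complex.Im (a%:C * z + w) = a * complex.Im z + complex.Im w.
Proof. by case: z w => [z1 z2] [w1 w2] /=; rewrite mul0r addr0. Qed.
End ComplexParts.

(** * The exponential of an endomorphism and the closure of the adjoint group *)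

Section LfunExp.
Local Open Scope classical_set_scope.
Local Open Scope complex_scope.
Variables (R : realType) (g : lieAlgType R).
Local Notation lmx := (@lmx R g).
Local Notation b := (vbasis {:'End(g)}).
Local Notation C := R[i].
Local Notation toC := (real_complex R).

Definition mxlfun (A : 'M[R]_(\dim {:g})) : 'End(g) :=
  hommx (vbasis {:g}) (vbasis {:g}) A.

Lemma lmxK : cancel lmx mxlfun.
Proof. exact: (mxofK (vbasisP _) (vbasisP _)). Qed.

Lemma mxlfunK : cancel mxlfun lmx.
Proof. exact: (hommxK (vbasisP _) (vbasisP _)). Qed.

Lemma mxlfun_linear a A B : mxlfun (a *: A + B) = a *: mxlfun A + mxlfun B.
Proof. exact: linearP. Qed.

(** [lfun_expR] is summed in coordinates of a basis of ['End(g)]. These are linear functionals of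
    the matrix entries, so entrywise limits determine it. *)
Lemma lfun_expR_cvg (f e : 'End(g)) :
  (forall i j, (fun m => texp m (lmx f) i j) @ \oo --> lmx e i j) -> lfun_expR f = e.
Proof.
move=> H; rewrite [RHS](coord_vbasis (memvf e)); apply: eq_bigr => i _; congr (_ *: _).
have lin a A B : coord b i (mxlfun (a *: A + B)) = a * coord b i (mxlfun A) + coord b i (mxlfun B).
  by rewrite mxlfun_linear linearP.
have := cvg_mx_linear (T := fun m => texp m (lmx f)) lin H; rewrite lmxK => cv.
rewrite (_ : series _ = fun m => coord b i (mxlfun (texp m (lmx f)))); first exact: cvg_lim cv.
apply/funext => m; rewrite /series /= big_mkord /texp /mxlfun linear_sum linear_sum.
apply: eq_bigr => k _; rewrite linearZ linearZ /= -lmx_pow -/(mxlfun _) lmxK.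
by rewrite mulrC.
Qed.

Lemma lfun_expR_nilpotent (f : 'End(g)) k : lmx f ^+ k = 0 ->
  lfun_expR f = mxlfun (texp k (lmx f)).
Proof.
move=> fk; apply: lfun_expR_cvg => i j; rewrite mxlfunK; apply: cvg_near_cst.
by exists k => // m /= km; rewrite (texp_nilpotent fk).
Qed.

(* With divided powers, Leibniz' rule has no binomial coefficients. *)
Definition divpow (f : 'End(g)) k x : g := k`!%:R^-1 *: lfun_pow f k x.

Lemma divpowS (f : 'End(g)) k x : f (divpow f k x) = k.+1%:R *: divpow f k.+1 x.
Proof.
rewrite /divpow linearZ lfun_powS comp_lfunE [RHS]scalerA factS natrM invfM mulrA.
by rewrite divff ?mul1r // pnatr_eq0.
Qed.

Lemma divpow_lie (f : 'End(g)) m x y : derivation f ->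
  divpow f m (lie x y) = \sum_(j < m.+1) lie (divpow f j x) (divpow f (m - j) y).
Proof.
move=> df; elim: m => [|m IH].
  by rewrite big_ord_recl big_ord0 addr0 /divpow fact0 invr1 !scale1r /lfun_pow /= !id_lfunE.
apply: (scalerI (a := m.+1%:R)); first by rewrite pnatr_eq0.
rewrite -divpowS IH linear_sum.
have -> : \sum_(j < m.+1) f (lie (divpow f j x) (divpow f (m - j) y)) =
  \sum_(j < m.+1) j.+1%:R *: lie (divpow f j.+1 x) (divpow f (m.+1 - j.+1) y) +
  \sum_(j < m.+1) (m.+1 - j)%:R *: lie (divpow f j x) (divpow f (m.+1 - j) y).
  rewrite -big_split; apply: eq_bigr => j _ /=.
  by rewrite df !divpowS lieZl lieZr subSS subSn // -ltnS.
pose F j := lie (divpow f j x) (divpow f (m.+1 - j) y).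
have -> : \sum_(j < m.+1) j.+1%:R *: lie (divpow f j.+1 x) (divpow f (m.+1 - j.+1) y)
    = \sum_(j < m.+2) j%:R *: F j.
  by rewrite [RHS]big_ord_recl scale0r add0r.
have -> : \sum_(j < m.+1) (m.+1 - j)%:R *: lie (divpow f j x) (divpow f (m.+1 - j) y)
    = \sum_(j < m.+2) (m.+1 - j)%:R *: F j.
  by rewrite [RHS]big_ord_recr /= subnn scale0r addr0.
rewrite -big_split scaler_sumr; apply: eq_bigr => j _ /=.
by rewrite -scalerDl -natrD subnKC // -ltnS.
Qed.

Lemma texp_divpow (f : 'End(g)) k x : mxlfun (texp k (lmx f)) x = \sum_(j < k) divpow f j x.
Proof.
rewrite /texp /mxlfun linear_sum sum_lfunE; apply: eq_bigr => j _.
by rewrite linearZ /= scale_lfunE -lmx_pow -/(mxlfun _) lmxK.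
Qed.

Lemma texp_automorphism (f : 'End(g)) k : derivation f -> lfun_pow f k = 0 ->
  lie_automorphism (mxlfun (texp k (lmx f))).
Proof.
move=> df fk; have fk' : lmx f ^+ k = 0 by rewrite -lmx_pow fk linear0.
split.
  apply/eqP/lker0P; apply: (can_inj (g := mxlfun (texp k (- lmx f)))) => x.
  rewrite -comp_lfunE -[RHS](id_lfunE x); congr fun_of_lfun; apply: lmx_inj.
  rewrite lmx_comp !mxlfunK lmx1; case: k fk' {fk} => [|k] fk'.
    have M1 : (1%:M : 'M[R]_(\dim {:g})) = 0 by rewrite expr0 in fk'.
    by rewrite -[LHS]mulmx1 M1 mulmx0.
  rewrite -(texp0 R _ k) -[0 in RHS](scale0r (lmx f)) -(addNr (1 : R)) texpD_nil //.
  by rewrite scale1r scaleN1r.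
move=> x y; have dk j z : (k <= j)%N -> divpow f j z = 0.
  move=> kj; rewrite /divpow lfun_powE -(subnK kj) iterD -!lfun_powE fk.
  by rewrite zero_lfunE linear0 scaler0.
have trunc m z : (k <= m)%N -> \sum_(j < m) divpow f j z = \sum_(j < k) divpow f j z.
  move=> km; rewrite -(subnKC km) big_split_ord /= [X in _ + X]big1 ?addr0 // => i _.
  by rewrite dk // leq_addr.
(* At order k + k the triangle of index pairs contains the whole square below k, outside which one
   of the two factors is 0. *)
rewrite !texp_divpow -(trunc (k + k)%N) ?leq_addr //.
under eq_bigr do rewrite divpow_lie //.
rewrite (sum_triangle (fun i j => lie (divpow f i x) (divpow f j y))).
rewrite big_split_ord /= [X in _ + X]big1 ?addr0 => [|i _]; last first.
  by apply: big1 => j _; rewrite dk ?leq_addr // lie0l.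
rewrite lieC linear_sum -sumrN; apply: eq_bigr => i _ /=.
rewrite -lieC -(trunc (k + k - i)%N) ?linear_sum //.
by rewrite -addnBA ?leq_addr // ltnW.
Qed.

Lemma Inn_pow (x : g) n : @Inn R g (lfun_pow (lfun_expR (ad x)) n).
Proof. by exists (nseq n x); elim: n => //= n ->. Qed.

(* On the powers of exp (tau ad x) = exp (tau S) exp (tau N), a polynomial p is
   an exponential polynomial in n, with frequencies from S and polynomial
   coefficients from N. Its vanishing separates the two variables. *)
Theorem nilpotent_part_in_hull (x : g) q k :
  derivation (ad x - lpoly q (ad x)) ->
  lfun_pow (ad x - lpoly q (ad x)) k = 0 ->
  (exists P d, P \in unitmx /\ P *m cmx (lpoly q (ad x)) = diag_mx d *m P) ->
  lie_algebra_of (zariski_closure (@Inn R g)) (ad x - lpoly q (ad x)).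
Proof.
set S := lpoly q (ad x); set N := ad x - S => dN Nk [P [d [Pu PS]]] t.
have tNm u : (u *: lmx N) ^+ k = 0 by rewrite exprZmx -lmx_pow Nk linear0 scaler0.
have tN u : lmx (u *: N) ^+ k = 0 by rewrite linearZ /= tNm.
rewrite (lfun_expR_nilpotent (tN t)); split.
  apply: texp_automorphism; last by apply: lmx_inj; rewrite lmx_pow tN linear0.
  by move=> y z; rewrite !scale_lfunE dN scalerDr lieZl lieZr.
move=> p Hp.
have SN : lmx S *m lmx N = lmx N *m lmx S.
  rewrite -!lmx_comp; congr lmx; apply/lfunP => v.
  by rewrite !comp_lfunE !(add_lfunE, opp_lfunE) [S (_ - _)]linearB /= lpoly_commute.
(* Small enough for the exponential of tau S to be invertible; the + 1 keeps the denominator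
   positive when S = 0. *)
pose tau : R := (4 * (mnorm (lmx S) + 1))^-1.
have mn0 := mnorm_ge0 (lmx S).
have tau0 : 0 < tau by rewrite invr_gt0 mulr_gt0 //; lra.
pose X := tau *: lmx S.
have Xs : mnorm X <= 4^-1.
  rewrite mnormZ (ger0_norm (ltW tau0)) /tau invfM -mulrA ler_piMr ?invr_ge0 //.
  rewrite mulrC ler_pdivrMr ?mul1r; lra.
have [E cE] := texp_small_cvg Xs.
have Eu := texp_small_unit Xs cE.
have XN : X *m lmx N = lmx N *m X by rewrite -scalemxAl SN scalemxAr.
have commT m : texp m X *m lmx N = lmx N *m texp m X.
  rewrite mulmx_suml mulmx_sumr; apply: eq_bigr => j _.
  rewrite -scalemxAl -scalemxAr; congr (_ *: _).
  by apply: esym; apply: (@commrX _ (lmx N) X j); exact: esym.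
have EN : E *m lmx N = lmx N *m E.
  apply/matrixP => i j; apply/eqP; rewrite -subr_eq0; apply/eqP.
  apply: (cvg_mx_linear0 (T := fun m => texp m X)
     (psi := fun A => (A *m lmx N) i j - (lmx N *m A) i j)) => //.
    move=> a A B; rewrite mulmxDl mulmxDr -scalemxAl -scalemxAr !mxE; ring.
  by move=> m; rewrite commT subrr.
pose A := lfun_expR (ad (tau *: x)).
have AE : lmx A = E *m texp k (tau *: lmx N).
  rewrite /A -[E *m _]mxlfunK; congr lmx; apply: lfun_expR_cvg => i j.
  rewrite mxlfunK linearZ linearZ /=.
  have -> : tau *: lmx (ad x) = tau *: lmx N + X.
    by rewrite /X -scalerDr /N linearB /= subrK.
  have tNk := tNm tau.
  have cS : (fun m => (\sum_(l < k) texp (m - l)%N X *m (l`!%:R^-1 *: (tau *: lmx N) ^+ l)) i j)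
     @ \oo --> (E *m texp k (tau *: lmx N)) i j.
    rewrite /texp mulmx_sumr summxE (_ : (fun m => _) = fun m => \sum_(l < k)
       (texp (m - l)%N X *m (l`!%:R^-1 *: (tau *: lmx N) ^+ l)) i j); last first.
      by apply/funext => m; rewrite summxE.
    apply: cvgn_sum => l; rewrite -(cvg_shiftn l) /=.
    rewrite (_ : (fun m => _) = fun m => (texp m X *m (l`!%:R^-1 *: (tau *: lmx N) ^+ l)) i j); last first.
      by apply/funext => m; rewrite addnK.
    apply: (cvg_mx_linear (T := fun m => texp m X)
      (psi := fun A => (A *m (l`!%:R^-1 *: (tau *: lmx N) ^+ l)) i j)) => //.
    by move=> a B1 B2; rewrite mulmxDl -scalemxAl !mxE.
  apply: cvg_trans cS; apply: near_eq_cvg; exists k => // m /= km.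
  by rewrite (texpD_nilpotent _ tNk) // -scalemxAl -XN scalemxAr.
(* As a limit of matrices diagonal in the frame P, E is diagonal there; being invertible it has
   non-zero entries, which are the bases of the exponential polynomials. *)
have [eps [eps0 PE]] : exists eps : 'rV[C]_(\dim {:g}), (forall i, eps 0 i != 0) /\
    P *m map_mx toC E = diag_mx eps *m P.
  have PX j : P *m map_mx toC (X ^+ j) *m invmx P = diag_mx (map_mx (fun z => (tau%:C * z) ^+ j) d).
    elim: j => [|j IH].
      rewrite expr0 map_mx1 mulmx1 mulmxV //; apply/matrixP => i l; rewrite !mxE.
      by rewrite expr0.
    have PX1 : P *m map_mx toC X = diag_mx (tau%:C *: d) *m P.
      by rewrite /X map_mxZ -scalemxAr PS scalemxAl -linearZ.
    rewrite exprS map_mxM mulmxA PX1 -!mulmxA [P *m _]mulmxA IH mulmx_diag.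
    by congr diag_mx; apply/rowP => i; rewrite !mxE exprS.
  have off i j : i != j -> (P *m map_mx toC E *m invmx P) i j = 0.
    move=> ij; have Tij m : (P *m map_mx toC (texp m X) *m invmx P) i j = 0.
      rewrite /texp map_mx_sum mulmx_sumr mulmx_suml summxE big1 // => l _.
      by rewrite map_mxZ -scalemxAr -scalemxAl PX !mxE (negbTE ij) mulr0.
    have lin (a : R) (B1 B2 : 'M[R]_(\dim {:g})) : (P *m map_mx toC (a *: B1 + B2) *m invmx P) i j =
        a%:C * (P *m map_mx toC B1 *m invmx P) i j + (P *m map_mx toC B2 *m invmx P) i j.
      by rewrite map_mxD map_mxZ mulmxDr mulmxDl -scalemxAr -scalemxAl mxE [in LHS]mxE.
    apply/eqP; rewrite eq_complex; apply/andP; split; apply/eqP.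
      apply: (cvg_mx_linear0 (T := fun m => texp m X)
        (psi := fun B => complex.Re ((P *m map_mx toC B *m invmx P) i j))) => //.
        by move=> a B1 B2; rewrite lin ReZD.
      by move=> m; rewrite Tij.
    apply: (cvg_mx_linear0 (T := fun m => texp m X)
      (psi := fun B => complex.Im ((P *m map_mx toC B *m invmx P) i j))) => //.
      by move=> a B1 B2; rewrite lin ImZD.
    by move=> m; rewrite Tij.
  pose D := P *m map_mx toC E *m invmx P.
  have DE : D = diag_mx (\row_i D i i).
    apply/matrixP => i j; rewrite [RHS]mxE.
    have [->|ij] := eqVneq i j; first by rewrite mulr1n [RHS]mxE.
    by rewrite [LHS]off.
  exists (\row_i D i i); split; last by rewrite -DE /D mulmxKV.
  have : D \in unitmx by rewrite !unitmx_mul Pu map_unitmx Eu unitmx_inv.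
  rewrite {1}DE unitmxE det_diag unitfE => /prodf_neq0 H i; exact: H.
have tauk u : (u *: (tau *: lmx N)) ^+ k = 0.
  by rewrite scalerA tNm.
(* The powers of A are the values on the diagonal u = n of this two-variable family. *)
pose B n u := E ^+ n *m texp k (u *: (tau *: lmx N)).
have BA (n : nat) : lmx (lfun_pow A n) = B n n%:R.
  elim: n => [|n IH].
    rewrite lmx1 /B expr0 mul1mx scale0r; case: (k) Nk => [|k'] Nk; last by rewrite texp0.
    have M1 : (1%:M : 'M[R]_(\dim {:g})) = 0 by rewrite -lmx1 -[\1%VF]/(lfun_pow N 0) Nk linear0.
    by rewrite M1 /texp big_ord0.
  have comm : texp k (n%:R *: (tau *: lmx N)) *m E = E *m texp k (n%:R *: (tau *: lmx N)).
    rewrite mulmx_suml mulmx_sumr; apply: eq_bigr => j _.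
    rewrite -scalemxAl -scalemxAr; congr (_ *: _).
    apply: esym; apply: (@commrX _ E); rewrite /GRing.comm -[LHS]/(_ *m _) -[RHS]/(_ *m _).
    by rewrite -!scalemxAr -!scalemxAl EN.
  rewrite lfun_powS lmx_comp IH AE /B.
  set t1 := texp k (tau *: lmx N); set tn := texp k (n%:R *: _).
  have -> : E ^+ n *m tn *m (E *m t1) = (E ^+ n *m E) *m (tn *m t1).
    by rewrite !mulmxA -[_ *m tn *m E]mulmxA comm !mulmxA.
  rewrite exprSr -natr1 [_ + 1]addrC texpD_nil ?scale1r //; exact: tNm.
have expB i j : exp_poly (fun n u => ((B n u) i j)%:C).
  have -> : (fun n u => ((B n u) i j)%:C) = (fun n u => \sum_l
      (\sum_m invmx P i m * eps 0 m ^+ n * P m l) *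
      \sum_(c < k) ((c`!%:R^-1 *: ((tau *: lmx N) ^+ c)) l j)%:C * u%:C ^+ c).
    apply/funext => n; apply/funext => u; rewrite /B mxE rmorph_sum; apply: eq_bigr => l _ /=.
    rewrite rmorphM; congr (_ * _).
      have En : map_mx toC (E ^+ n) = invmx P *m diag_mx (map_mx (fun z => z ^+ n) eps) *m P.
        elim: n => [|n IH].
          rewrite expr0 map_mx1 (_ : map_mx _ eps = const_mx 1) ?diag_const_mx ?mulmx1 ?mulVmx //.
          by apply/rowP => m; rewrite !mxE expr0.
        have Dn : diag_mx (map_mx (fun z => z ^+ n) eps) *m diag_mx eps
            = diag_mx (map_mx (fun z => z ^+ n.+1) eps).
          by rewrite mulmx_diag; congr diag_mx; apply/rowP => m; rewrite !mxE exprSr.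
        rewrite exprSr map_mxM IH -[_ *m P *m _]mulmxA PE.
        by rewrite -Dn !mulmxA.
      have := congr1 (fun M : 'M[C]_(\dim {:g}) => M i l) En; rewrite mxE => H; apply: etrans H _.
      rewrite mxE; apply: eq_bigr => m _; rewrite mul_mx_diag !mxE //.
    rewrite /texp summxE rmorph_sum; apply: eq_bigr => c _.
    by rewrite exprZmx scalerA mulrC -scalerA mxE rmorphM rmorphXn mulrC.
  apply: exp_poly_sum => l _; apply: exp_polyM; apply: exp_poly_sum => m _.
    apply: exp_polyM; last exact: exp_poly_cst.
    by apply: exp_polyM; [exact: exp_poly_cst | exact: exp_poly_exp].
  apply: exp_polyM; first exact: exp_poly_cst.
  apply: exp_polyX; apply: exp_poly_ext (exp_poly_poly 'X) => n u; exact: hornerX.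
pose G n u : C := (poly_lfun_eval p (mxlfun (B n u)))%:C.
have expG : exp_poly G.
  have -> : G = fun n u => \sum_(m <- mpoly.msupp p) (mpoly.mcoeff m p)%:C *
      \prod_i (\sum_a \sum_c ((B n u) a c)%:C * (coord b i (mxlfun (delta_mx a c)))%:C) ^+
        mpoly.fun_of_multinom m i.
    apply/funext => n; apply/funext => u; rewrite /G /poly_lfun_eval mpoly.mevalE rmorph_sum.
    apply: eq_bigr => m _ /=; rewrite rmorphM rmorph_prod; congr (_ * _).
    apply: eq_bigr => i _; rewrite rmorphXn; congr (_ ^+ _).
    rewrite {1}[B n u]matrix_sum_delta /mxlfun linear_sum linear_sum rmorph_sum.
    apply: eq_bigr => a _; rewrite linear_sum linear_sum rmorph_sum.
    by apply: eq_bigr => c _; rewrite linearZ linearZ /= rmorphM.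
  apply: exp_poly_sum => m _; apply: exp_polyM; first exact: exp_poly_cst.
  apply: exp_poly_prod => i _; apply: exp_polyX.
  apply: exp_poly_sum => a _; apply: exp_poly_sum => c _.
  by apply: exp_polyM; [exact: expB | exact: exp_poly_cst].
(* Off the diagonal, n = 0 removes the semisimple factor and u = t / tau leaves the exponential of t
   N. *)
have G0 : G 0%N (t / tau) = 0.
  apply: (exp_poly_diag0 expG) => n; rewrite /G -BA lmxK Hp ?rmorph0 //.
  exact: Inn_pow.
have -> : texp k (lmx (t *: N)) = B 0%N (t / tau).
  by rewrite /B expr0 mul1mx scalerA -mulrA mulVf ?gt_eqF // mulr1 linearZ.
by apply: complexI; rewrite rmorph0; exact: G0.
Qed.
End LfunExp.

(** * Invariance under the radical and the noncompact Levi factor *)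

Section Fitting.
Variables (F : fieldType) (V : vectType F) (f : 'End(V)).
Local Notation fpow := (lfun_pow f).

Lemma lfun_powD j k v : fpow (j + k) v = fpow j (fpow k v).
Proof. by rewrite !lfun_powE iterD. Qed.

Lemma limg_pow_decr j k : (limg (fpow (j + k)) <= limg (fpow j))%VS.
Proof. by apply/subvP => _ /memv_imgP[u _ ->]; rewrite lfun_powD memv_img ?memvf. Qed.

(** Any m for which the image of the m-th power has least dimension will do, since the images of all
    higher powers then coincide with it. *)
Lemma fitting : exists m,
  [/\ forall v, exists v0 v1, [/\ v = v0 + v1, fpow m v0 = 0 & v1 \in limg (fpow m)],
      forall v, v \in limg (fpow m) -> exists2 u, u \in limg (fpow m) & v = f u &
      forall v, v \in limg (fpow m) -> v \in limg (fpow (m + m))].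
Proof.
have [m Hm] : exists m, forall k, (\dim (limg (fpow m)) <= \dim (limg (fpow k)))%N.
  pose P d := boolp.asbool (exists k, \dim (limg (fpow k)) = d).
  have exP : exists d, P d by exists (\dim (limg (fpow 0))); apply/boolp.asboolP; exists 0%N.
  have [d /boolp.asboolP[m <-] min] := ex_minnP exP.
  by exists m => k; apply: min; apply/boolp.asboolP; exists k.
have stab j v : v \in limg (fpow m) -> v \in limg (fpow (m + j)).
  have : (limg (fpow (m + j)) == limg (fpow m))%VS by rewrite eqEdim limg_pow_decr Hm.
  by move=> /eqP ->.
exists m; split=> [v|v /(stab 1%N)|v /(stab m) //].
  have /memv_imgP[u _ E] : fpow m v \in limg (fpow (m + m)).
    by apply: stab; rewrite memv_img ?memvf.
  exists (v - fpow m u), (fpow m u); rewrite subrK memv_img ?memvf; split => //.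
  by rewrite linearB /= E lfun_powD subrr.
rewrite addn1 => /memv_imgP[u _ ->]; exists (fpow m u); first by rewrite memv_img ?memvf.
by rewrite lfun_powS comp_lfunE.
Qed.
End Fitting.

Section FittingLie.
Variables (F : fieldType) (g : lieAlgType F) (f : 'End(g)).
Hypothesis df : derivation f.

(** Induction through [z, f w] = f [z, w] - [f z, w]: the first term gains a power of f, the second
    lowers the order j of z. So the bracket of the null component with the one-component stays in
    the latter. *)
Lemma lie_fitting j n z u : lfun_pow f j z = 0 ->
  lie z (lfun_pow f (n + j) u) \in limg (lfun_pow f n).
Proof.
elim: j n z u => [|j IHj] n z u zj.
  by rewrite /lfun_pow /= id_lfunE in zj; rewrite zj lie0l mem0v.
elim: n u => [|n IHn] u; first by rewrite /lfun_pow /= lim1g memvf.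
rewrite addSn lfun_powS comp_lfunE; set w := lfun_pow f _ u.
have -> : lie z (f w) = f (lie z w) - lie (f z) w by rewrite df addrC addKr.
apply: memvB.
  have /memv_imgP[v _ ->] := IHn u.
  by rewrite -comp_lfunE -lfun_powS memv_img ?memvf.
rewrite /w -addSnnS; apply: IHj; rewrite lfun_powE -iterSr -lfun_powE //.
Qed.
End FittingLie.

(** * Elements that leave the form invariant *)

Section Invariance.
Variables (R : realType) (g : lieAlgType R) (form : {symmetric g}).
Implicit Types (x y z : g) (U I J K s r : {vspace g}).

Lemma symmetricC x y : form x y = form y x.
Proof. by rewrite hermC expr0 mul1r. Qed.

Lemma formDl x y z : form (x + y) z = form x z + form y z. Proof. exact: linearDl. Qed.
Lemma formDr x y z : form z (x + y) = form z x + form z y. Proof. exact: linearDr. Qed.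
Lemma formNl x z : form (- x) z = - form x z. Proof. exact: linearNl. Qed.
Lemma formNr x z : form z (- x) = - form z x. Proof. exact: linearNr. Qed.
Lemma formZl a x z : form (a *: x) z = a * form x z. Proof. exact: linearZl_LR. Qed.
Lemma formZr a x z : form z (a *: x) = a * form z x. Proof. exact: linearZr_LR. Qed.

Definition form_invariant x := forall y z, form (lie x y) z = - form y (lie x z).

Lemma form_invariant0 : form_invariant 0.
Proof. by move=> y z; rewrite !lie0l linear0l linear0r oppr0. Qed.

Lemma form_invariantD x y : form_invariant x -> form_invariant y -> form_invariant (x + y).
Proof. by move=> Hx Hy u v; rewrite !lieDl formDl formDr opprD Hx Hy. Qed.

Lemma form_invariantZ a x : form_invariant x -> form_invariant (a *: x).
Proof. by move=> Hx u v; rewrite !lieZl formZl formZr Hx mulrN. Qed.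

Lemma form_invariant_sum (I : eqType) (t : seq I) (X : I -> g) :
  (forall i, i \in t -> form_invariant (X i)) -> form_invariant (\sum_(i <- t) X i).
Proof.
elim: t => [|i t IH] H; first by rewrite big_nil; exact: form_invariant0.
rewrite big_cons; apply: form_invariantD; first by apply: H; rewrite mem_head.
by apply: IH => j jt; apply: H; rewrite inE jt orbT.
Qed.

Lemma form_invariant_lie x y : form_invariant x -> form_invariant y ->
  form_invariant (lie x y).
Proof.
move=> Hx Hy u v.
have E w : lie (lie x y) w = lie x (lie y w) - lie y (lie x w).
  by rewrite [lie x (lie y w)]lie_derivation addrK.
by rewrite !E formDl formNl formDr formNr Hx Hy Hy Hx !opprK opprB.
Qed.

Hypothesis nil_inv : nil_invariant form.

(** S is the semisimple part of [ad x]. Nil-invariance applies to [ad x - S] only; the vanishing of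
    S on the generalized null space of [ad x] recovers [ad x] itself there. *)
Lemma nilpotent_part_skew x : exists S : 'End(g),
  (forall k v, lfun_pow (ad x) k v = 0 -> S v = 0) /\
  forall u v, form ((ad x - S) u) v = - form u ((ad x - S) v).
Proof.
have [q [dS [k Nk] S0 PS]] := jordan_derivation (derivation_ad x).
exists (lpoly q (ad x)); split => //; apply: nil_inv; last by exists k.
apply: (nilpotent_part_in_hull (k := k)) => // u v.
rewrite !(add_lfunE, opp_lfunE) dS derivation_ad lieBl lieBr opprD addrACA //.
Qed.

Lemma ad_nilpotent_invariant x : lfun_nilpotent (ad x) -> form_invariant x.
Proof.
case=> k xk; have [S [S0 HS]] := nilpotent_part_skew x.
have {}S0 : S = 0.
  by apply/lfunP => v; rewrite zero_lfunE (S0 k) // xk zero_lfunE.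
by move=> y z; rewrite -!adE; have := HS y z; rewrite S0 subr0.
Qed.

Lemma radical_invariant r x : lie_ideal fullv r -> lie_solvable r -> x \in r ->
  form_invariant x.
Proof.
move=> Hr solr xr.
have [N [HN nilN rN]] := solvable_ideal_bracket_nilpotent Hr solr.
have [S [S0 HS]] := nilpotent_part_skew x.
have [m [split1 surj stab]] := fitting (ad x).
set V1 := limg (lfun_pow (ad x) m) in split1 surj stab.
(* V1 = [x, V1] lies in [g, r], which acts nilpotently. *)
have invV1 y : y \in V1 -> form_invariant y.
  move=> /surj[u _ ->]; apply/ad_nilpotent_invariant/(acts_nilpotently_ad nilN).
  rewrite adE lieC memvN; apply: (subvP rN); apply: mem_lie_span => //; exact: memvf.
(* With w = [x, w'] and w' invariant, form x [w', x] equals its own opposite. *)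
have xV1 w : w \in V1 -> form x w = 0.
  move=> /surj[w' /invV1 Hw' ->]; rewrite adE lieC formNr.
  have := Hw' x x; rewrite symmetricC => /eqP; rewrite -addr_eq0 -mulr2n mulrn_eq0 /= => /eqP ->.
  by rewrite oppr0.
have lieV01 y z : y \in V1 -> lfun_pow (ad x) m z = 0 -> lie z y \in V1.
  move=> /stab/memv_imgP[u _ ->] zm; apply: lie_fitting => //; exact: derivation_ad.
have V1_lie y z : y \in V1 -> form (lie x y) z = form x (lie y z).
  by move=> /invV1 Hy; rewrite lieC formNl Hy opprK.
(* Writing y = [x, u] with u in V1 turns the pairing into that of x with [u, z], an element of
   V1. *)
have V10 y z : y \in V1 -> lfun_pow (ad x) m z = 0 -> form y z = 0.
  move=> /surj[u uV1 ->] zm; rewrite adE V1_lie // lieC formNr xV1 ?oppr0 //.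
  exact: lieV01.
have DV1 y : y \in V1 -> lie x y \in V1.
  move=> /memv_imgP[u _ ->]; rewrite -adE -comp_lfunE -lfun_powS lfun_powE iterSr -lfun_powE.
  by rewrite memv_img ?memvf.
have DV0 z : lfun_pow (ad x) m z = 0 -> lfun_pow (ad x) m (lie x z) = 0.
  move=> zm; rewrite -adE lfun_powE -iterSr iterS -lfun_powE zm linear0 //.
move=> y z.
have [y0 [y1 [-> y0m y1V]]] := split1 y; have [z0 [z1 [-> z0m z1V]]] := split1 z.
(* On the null component S vanishes, so the skew operator there is [ad x]. *)
have E00 : form (lie x y0) z0 = - form y0 (lie x z0).
  have := HS y0 z0; rewrite !(add_lfunE, opp_lfunE) (S0 m) // (S0 m) // !subr0 !adE //.
have E11 : form (lie x y1) z1 = - form y1 (lie x z1).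
  by rewrite V1_lie // symmetricC [in RHS]symmetricC V1_lie // [lie z1 y1]lieC formNr opprK symmetricC.
have E01 : form (lie x y0) z1 = 0 by rewrite symmetricC V10 // DV0.
have E10 : form (lie x y1) z0 = 0 by rewrite V10 // DV1.
have F01 : form y0 (lie x z1) = 0 by rewrite symmetricC V10 // DV1.
have F10 : form y1 (lie x z0) = 0 by rewrite V10 // DV0.
by rewrite !lieDr !formDl !formDr E00 E11 E01 E10 F01 F10 !addr0 !add0r opprD.
Qed.

(** Let w be an eigenvector of the real part rho of [ad h], with eigenvalue a != 0. Since rho is a
    derivation, a ad w = [rho, ad w], so cyclicity of the trace kills the trace of every positive
    power of [ad w]. *)
Lemma real_part_invariant s h q x : lie_subalgebra s -> h \in s ->
  real_part_poly (ad h) q -> x \in s -> form_invariant (lpoly q (ad h) x).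
Proof.
move=> subs hs Hq xs; have [t [e [sum_e eig]]] := real_part_eigen Hq.
rewrite sum_e; apply: form_invariant_sum => a _.
have [->|a0] := eqVneq a 0; first by rewrite scale0r; exact: form_invariant0.
apply: form_invariantZ; set w := lpoly (e a) _ x.
apply: ad_nilpotent_invariant; apply: nilpotent_of_traces => k.
have /derivation_adP dq := real_part_derivation Hq (derivation_ad h).
have E : a *: ad w = (lpoly q (ad h) \o ad w)%VF - (ad w \o lpoly q (ad h))%VF.
  by rewrite -dq eig linearZ.
suff: ltr (a *: lfun_pow (ad w) k.+1) = 0.
  by rewrite linearZ /= => /eqP; rewrite mulf_eq0 (negbTE a0) => /eqP.
have -> : a *: lfun_pow (ad w) k.+1 =
   (lpoly q (ad h) \o lfun_pow (ad w) k.+1)%VF -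
   (ad w \o (lpoly q (ad h) \o lfun_pow (ad w) k))%VF.
  rewrite lfun_powS comp_lfunZl E; apply/lfunP => v.
  by rewrite !(comp_lfunE, add_lfunE, opp_lfunE).
rewrite linearB /= [X in _ - X]ltr_comp -comp_lfunA.
rewrite (_ : (lfun_pow (ad w) k \o ad w)%VF = lfun_pow (ad w) k.+1) ?subrr //.
by apply/lfunP => v; rewrite comp_lfunE !lfun_powE -iterSr.
Qed.

(** With s1 the image of s under the real part rho, J = s1 + [s1, s1] is an ideal: modulo s1 every x
    of s may be taken in the kernel of rho, and then [x, rho y] = rho [x, y]. *)
Lemma real_part_ideal s h q : lie_subalgebra s -> h \in s -> real_part_poly (ad h) q ->
  exists J, [/\ lie_ideal s J, forall x, x \in J -> form_invariant x &
    forall x, x \in s -> lpoly q (ad h) x \in J].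
Proof.
move=> subs hs Hq; set rho := lpoly q (ad h); pose s1 := (rho @: s)%VS.
have rho_s p x : x \in s -> lpoly p (ad h) x \in s.
  by apply: lpoly_stable => v vs; rewrite adE subs.
have s1s : (s1 <= s)%VS by apply/subvP => _ /memv_imgP[x xs ->]; apply: rho_s.
have dq := real_part_derivation Hq (derivation_ad h).
have [p Hp] := real_part_split Hq.
pose J := (s1 + lie_span s1 s1)%VS.
have s_s1 x y : x \in s -> y \in s1 -> lie x y \in J.
  move=> xs ys1; pose x1 := rho (lpoly p (ad h) x).
  have x1s : x1 \in s1 by rewrite memv_img // rho_s.
  rewrite -(subrK x1 x) lieDl; apply: memv_add; last exact: mem_lie_span.
  have /memv_imgP[y' ys' ->] := ys1.
  have r0 : rho (x - x1) = 0 by rewrite linearB /= Hp subrr.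
  have -> : lie (x - x1) (rho y') = rho (lie (x - x1) y') by rewrite dq r0 lie0l add0r.
  by rewrite memv_img // subs // memvB // (subvP s1s).
exists J; split.
- split.
    rewrite subv_add s1s; apply/lie_span_sub => x y /(subvP s1s) xs /(subvP s1s) ys; exact: subs.
  move=> x _ xs /memv_addP[y ys1 [z zs11 ->]]; rewrite lieDr; apply: memvD; first exact: s_s1.
  have [t [Ht ->]] := lie_span_sumP zs11.
  rewrite linear_sum big_seq memv_suml // => c /Ht[c1 c2] /=.
  rewrite lie_derivation memvD //.
    by apply: s_s1 => //; apply: subs => //; apply: (subvP s1s).
  rewrite lieC memvN s_s1 //; apply: subs => //; exact: (subvP s1s).
- have inv1 x : x \in s1 -> form_invariant x.
    by move=> /memv_imgP[u us ->]; apply: real_part_invariant us.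
  move=> _ /memv_addP[y /inv1 Hy [z zs11 ->]]; apply: form_invariantD => //.
  have [t [Ht ->]] := lie_span_sumP zs11; apply: form_invariant_sum => c /Ht[c1 c2].
  by apply: form_invariant_lie; apply: inv1.
by move=> x xs; apply: (subvP (addvSl _ _)); rewrite memv_img.
Qed.

(* J is a maximal ideal of s consisting of invariant elements; on its Killing
   complement all real parts vanish, so that complement is of compact type. *)
Lemma noncompact_invariant s x : lie_semisimple s -> no_compact_factor s ->
  x \in s -> form_invariant x.
Proof.
move=> sss ncs; have subs := sss.1.
pose P J := lie_ideal s J /\ forall y, y \in J -> form_invariant y.
have P0 : P 0%VS.
  split; first exact: lie_ideal0.
  by move=> y; rewrite memv0 => /eqP ->; exact: form_invariant0.
have [J [[HJ invJ] maxJ]] := exists_maximal_vspace P0.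
have [J' [HJ' sumJ capJ ssJ']] := semisimple_ideal_complement sss HJ.
suff J'0 : J' = 0%VS by rewrite -sumJ J'0 addv0; apply: invJ.
apply: (ncs J' J) => //; [by rewrite addvC | by rewrite capvC |].
split => //; apply: killing_semidefinite_definite => // h hJ'.
have hs := subvP HJ'.1 _ hJ'.
have [q Hq] := real_part_exists (ad h).
have [K [HK invK rhoK]] := real_part_ideal subs hs Hq.
have KJ : (K <= J)%VS.
  apply: subv_trans (addvSr J K) _; apply: maxJ; last exact: addvSl.
  split; first exact: lie_ideal_add.
  by move=> _ /memv_addP[a /invJ Ha [b /invK Hb ->]]; apply: form_invariantD.
have rho0 y : y \in J' -> lpoly q (ad h) y = 0.
  move=> yJ'; apply/eqP; rewrite -memv0 -capJ; apply/memv_capP; split.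
    by apply/(subvP KJ)/rhoK/(subvP HJ'.1).
  by apply: lpoly_stable yJ' => v vJ'; rewrite adE ssJ'.1.
pose L : lieAlgType R := sub_lie ssJ'.1.
pose v : 'Hom(L, g) := linfun (@vsval _ _ J').
have vE (y : L) : v y = vsval y by rewrite lfunE.
rewrite (killing_ad ssJ'.1) //; apply: (real_part0_tr_le0 Hq (h := v)).
- by move=> a b; rewrite !vE => /subvs_inj.
- by move=> y; rewrite !vE !adE (vsval_lie (subU := ssJ'.1)) vsprojK.
by move=> y; rewrite vE rho0 // subvsP.
Qed.

End Invariance.

(** * The kernel of the form *)

(** [ad x] is skew for the Killing form of k; definiteness makes its kernel and image in k meet in
    0, so that they span k. *)
Lemma definite_ad_fitting (R : realType) (g : lieAlgType R) (k : {vspace g}) x a :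
  lie_subalgebra k -> killing_definite k -> x \in k -> a \in k ->
  exists a0 a1, [/\ a0 \in k, a1 \in k, lie x a0 = 0 & a = a0 + lie x a1].
Proof.
move=> subk defk xk; pose f := ad x.
have killing0 u : u \in k -> killing k u u = 0 -> u = 0.
  move=> uk u0; apply/eqP/negPn/negP => nz.
  by case: defk => /(_ u uk nz); rewrite u0 ltxx.
have fk : (f @: k <= k)%VS by apply/subvP => _ /memv_imgP[u uk ->]; rewrite adE subk.
have cap0 : ((k :&: lker f) :&: (f @: k) = 0)%VS.
  apply/eqP; rewrite -subv0; apply/subvP => u /memv_capP[/memv_capP[uk]].
  rewrite memv_ker => /eqP fu /memv_imgP[b bk ub]; rewrite memv0; apply/eqP.
  apply: killing0 => //; rewrite {1}ub adE lieC -scaleN1r killingZl killing_lie //.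
  rewrite -adE fu; have := killingZr k 0 (0 : g) b; rewrite scale0r mul0r => ->.
  by rewrite mulr0.
have sum_k : ((k :&: lker f) + (f @: k) = k)%VS.
  apply/eqP; rewrite eqEdim subv_add capvSl fk /= dimv_disjoint_sum //.
  by rewrite limg_ker_dim.
rewrite -{1}sum_k => /memv_addP[a0 /memv_capP[a0k a0f] [_ /memv_imgP[a1 a1k ->] ->]].
exists a0, a1; split => //; last by rewrite adE.
by move: a0f; rewrite memv_ker adE => /eqP.
Qed.

Section Final.
Variables (R : realType) (g : lieAlgType R) (form : {symmetric g}).
Variables (k gs : {vspace g}).
Hypotheses (subk : lie_subalgebra k) (defk : killing_definite k).
Hypotheses (gs_ideal : lie_ideal fullv gs) (k_gs : (k + gs)%VS = fullv).
Hypothesis gs_inv : forall w, w \in gs -> form_invariant form w.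

Definition bracket_orth : {vspace g} := orthov form (lie_span fullv gs).
Local Notation t := bracket_orth.

Lemma mem_bracket_orth v :
  v \in t <-> forall x w, w \in gs -> form v (lie x w) = 0.
Proof.
split=> [/mem_orthovP H x w wgs|H]; first by apply: H; rewrite mem_lie_span ?memvf.
apply/mem_orthovP => _ /lie_span_sumP[l [Hl ->]]; rewrite big_seq.
elim/big_rec: _ => [|p y /Hl[_ p2] IH]; first exact: linear0r.
by rewrite formDr IH addr0 H.
Qed.

Lemma gs_lie x w : w \in gs -> lie x w \in gs.
Proof. by apply: (lie_idealP gs_ideal); rewrite memvf. Qed.

Lemma form_skew x y w : w \in gs -> form x (lie y w) = - form y (lie x w).
Proof.
move=> /gs_inv Hw; rewrite [lie y w]lieC [lie x w]lieC !formNr opprK.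
by rewrite [form x _]symmetricC Hw opprK.
Qed.

Lemma bracket_orth_kernel v w : v \in t -> w \in gs -> forall x, form x (lie v w) = 0.
Proof. by move=> /mem_bracket_orth vt wgs x; rewrite form_skew // vt // oppr0. Qed.

(** No invariance of x is assumed: the invariance of y and that of y' turn both sides into a pairing
    of x with a bracket of the two. *)
Lemma form_gs_inv x y y' : y \in gs -> y' \in gs ->
  form (lie x y) y' = - form y (lie x y').
Proof.
move=> ygs y'gs; rewrite lieC formNl (gs_inv ygs) opprK [lie x y']lieC formNr opprK.
by rewrite [RHS]symmetricC (gs_inv y'gs) [lie y' y]lieC formNr opprK.
Qed.

(** Since v brackets g_s into the kernel of the form, moving [ad v] across <a, [b, w]> leaves just
    the term in [b, [v, w]]; the skewness of the pairing does the rest. *)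
Lemma bracket_orth_selfadjoint v a b w : v \in t -> w \in gs ->
  form (lie v a) (lie b w) = form a (lie (lie v b) w).
Proof.
move=> vt wgs.
have E x y z : form x (lie (lie y z) w) = form x (lie y (lie z w)) - form x (lie z (lie y w)).
  by rewrite [lie y (lie z w)]lie_derivation formDr addrK.
have v0 x z : form x (lie v (lie z w)) = 0 by apply: bracket_orth_kernel => //; apply: gs_lie.
rewrite form_skew // !E !v0 !sub0r opprK form_skew ?opprK //; exact: gs_lie.
Qed.

Lemma bracket_orth_gs y u : u \in t -> u \in gs -> lie y u \in t.
Proof.
move=> /mem_bracket_orth ut ugs; apply/mem_bracket_orth => b w wgs.
by rewrite form_gs_inv ?gs_lie // ut ?oppr0 // gs_lie.
Qed.

Lemma bracket_orth_bracket v w : v \in t -> w \in gs -> lie v w \in t.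
Proof.
move=> vt wgs; apply/mem_bracket_orth => x z zgs.
by rewrite symmetricC bracket_orth_kernel.
Qed.

(** The condition on [x, v] is linear in x, so a finite intersection over a basis expresses it for
    all x and makes the set a subspace. *)
Definition bracket_orth1 : {vspace g} :=
  (t :&: \bigcap_(i < \dim {:g}) (ad (vbasis {:g})`_i @^-1: t))%VS.
Local Notation t1 := bracket_orth1.

Lemma mem_bracket_orth1 v : v \in t1 <-> v \in t /\ forall x, lie x v \in t.
Proof.
have E : v \in (\bigcap_(i < \dim {:g}) (ad (vbasis {:g})`_i @^-1: t))%VS <->
    forall i : 'I_(\dim {:g}), lie (vbasis {:g})`_i v \in t.
  rewrite memvE; split=> [/subv_bigcapP H i|H].
    by have := H i isT; rewrite -memvE -memv_preim adE.
  by apply/subv_bigcapP => i _; rewrite -memvE -memv_preim adE.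
split=> [/memv_capP[vt /E H]|[vt H]]; last by apply/memv_capP; split => //; apply/E => i.
split=> // x; rewrite (coord_vbasis (memvf x)) lieC memvN linear_sum memv_suml // => i _.
by rewrite /= lieZr memvZ // lieC memvN.
Qed.

(* For v in t1 the operators [y, [v, _]] are selfadjoint for the skew form
   <a, [b, w]>, so [y, [v, [v, a]]] lies in t; on k one may replace [v, _] by
   its square, ad v_k being semisimple there. *)
Lemma bracket_orth1_ideal : lie_ideal fullv t1.
Proof.
split=> [|x v _ /mem_bracket_orth1[vt v1]]; first exact: subvf.
have vr y : lie v y \in t by rewrite lieC memvN.
rewrite lieC memvN; apply/mem_bracket_orth1; split=> // y.
(* Write [y, [v, c]] = [v, [y, c]] - [[v, y], c]. The first term contributes 0 on both sides because
   [v, _] has values in t; the second is selfadjoint because [v, y] lies in t. *)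
have adj a b w : w \in gs ->
    form (lie y (lie v a)) (lie b w) = form a (lie (lie y (lie v b)) w).
  move=> wgs; have E c : lie y (lie v c) = lie v (lie y c) - lie (lie v y) c.
    by rewrite [lie v (lie y c)]lie_derivation addrC addKr.
  rewrite !E lieBl formDl formDr formNl formNr.
  rewrite (bracket_orth_selfadjoint _ _ (vr y)) //.
  have /mem_bracket_orth -> // := vr (lie y a).
  by rewrite (bracket_orth_kernel (vr _)).
(* After [adj] and skewness, the pairing is against [[v, a], w], which lies in the kernel of the
   form as [v, a] is in t. *)
have sq a : lie y (lie v (lie v a)) \in t.
  apply/mem_bracket_orth => b w wgs; rewrite adj // form_skew //.
  by rewrite bracket_orth_kernel ?oppr0.
have gs_t w : w \in gs -> lie y (lie v w) \in t.
  by move=> wgs; apply: bracket_orth_gs; [apply: bracket_orth_bracket | apply: gs_lie].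
have /memv_addP[xk xkk [xs xsgs ->]] : x \in (k + gs)%VS by rewrite k_gs memvf.
have /memv_addP[vk vkk [vs vsgs v_def]] : v \in (k + gs)%VS by rewrite k_gs memvf.
rewrite !lieDr; apply: memvD; last exact: gs_t.
(* The k-part of x splits as a0 + [vk, a1] with [vk, a0] = 0. Then [v, a0] = [vs, a0] lies in both t
   and g_s, while [v, [vk, a1]] is [v, [v, a1]], covered by [sq], minus [v, [vs, a1]], covered by
   [gs_t]. *)
have [a0 [a1 [a0k a1k va0 ->]]] := definite_ad_fitting subk defk vkk xkk.
rewrite !lieDr; apply: memvD.
  apply: bracket_orth_gs => //; rewrite v_def lieDl va0 add0r lieC memvN; exact: gs_lie.
have -> : lie vk a1 = lie v a1 - lie vs a1 by rewrite v_def lieDl addrK.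
rewrite !lieBr memvB //; apply: gs_t; rewrite lieC memvN; exact: gs_lie.
Qed.

(** Kernel invariance moves z from [z, x] onto [b, w], and [z, [b, w]] lies in the kernel because z
    is in t and [b, w] in g_s. *)
Lemma form_kernel_sub_bracket_orth1 : kernel_invariant form -> (form_kernel form <= t1)%VS.
Proof.
move=> Kinv; apply/subvP => z zK.
have z0 x : form z x = 0 by move/mem_orthovP: zK => ->; rewrite ?memvf.
have zt : z \in t by apply/mem_bracket_orth => x w _; apply: z0.
apply/mem_bracket_orth1; split => // x; rewrite lieC memvN.
apply/mem_bracket_orth => b w wgs; rewrite (Kinv z) //.
by rewrite bracket_orth_kernel ?oppr0 //; exact: gs_lie.
Qed.

Lemma bracket_orth1_sub_kernel : (lie_span t1 gs <= form_kernel form)%VS.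
Proof.
apply/lie_span_sub => v w /mem_bracket_orth1[vt _] wgs.
by apply/mem_orthovP => x _; rewrite symmetricC bracket_orth_kernel.
Qed.
End Final.

Theorem proposition6p13 (R : realType) (g : lieAlgType R)
    (form : {symmetric g}) (k s r : {vspace g}) :
  nil_invariant form ->
  levi_decomposition k s r ->
  (forall I : {vspace g},
     lie_ideal fullv I -> (I <= form_kernel form)%VS -> I = 0%VS) ->
  kernel_invariant form ->
  lie_span (form_kernel form) (s + r)%VS = 0%VS.
Proof.
move=> nil_inv [[r_ideal solr _] [ssk defk] [sss ncs] ks0 [ksr _]] noideal Kinv.
have ksr' : (k + (s + r) = fullv)%VS by rewrite addvA.
have gs_ideal : lie_ideal fullv (s + r)%VS.
  split=> [|x w _]; first exact: subvf.
  have : x \in (k + (s + r))%VS by rewrite ksr' memvf.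
  move=> /memv_addP[xk xkk [_ /memv_addP[xs xss [xr xrr ->]] ->]].
  move=> /memv_addP[ws wss [wr wrr ->]].
  (* The k-component acts trivially on s, so apart from a bracket inside s only brackets with the
     ideal r remain. *)
  have -> : lie (xk + (xs + xr)) (ws + wr)
      = lie xs ws + (lie xr ws + lie (xk + (xs + xr)) wr).
    by rewrite lieDr !lieDl ks0 // add0r -addrA.
  apply: memv_add; first exact: sss.1.
  by apply: memvD; [apply: (lie_idealPr r_ideal) | apply: (lie_idealP r_ideal)]; rewrite ?memvf.
have gs_inv w : w \in (s + r)%VS -> form_invariant form w.
  move=> /memv_addP[ws wss [wr wrr ->]]; apply: form_invariantD.
    exact: (noncompact_invariant nil_inv sss ncs).
  exact: (radical_invariant nil_inv r_ideal solr).
apply/eqP; rewrite -subv0.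
have <- : lie_span (bracket_orth1 form (s + r)) (s + r)%VS = 0%VS.
  apply: noideal; last exact: bracket_orth1_sub_kernel.
  apply: lie_ideal_span => //; exact: (bracket_orth1_ideal ssk.1 defk gs_ideal ksr' gs_inv).
by apply: lie_spanS; [exact: form_kernel_sub_bracket_orth1 | exact: subvv].
Qed.
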